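(* Let $C\subseteq\mathbb{F}_2^n$ be a binary linear $[n,k,d]$ code with $\mathbf{1}_n\in C$, whose dual $C^\perp$ has minimum distance $d^\perp$, and suppose that $t$ is a positive integer with $$d^\perp-t=\#\{u \mid C_u\neq\emptyset,\ 0<u\le n-t\}$$ and $(d^\perp,t)=(8,5)$. Then $C$ is the extended binary Golay code $\mathcal{G}_{24}$ (the unique binary $[24,12,8]$ code, up to equivalence).
   Context: $\mathbf{1}_n$ is the all-ones vector; $C^\perp$ is the dual code with respect to the standard inner product; $d^\perp$ is the minimum weight of a nonzero codeword of $C^\perp$; $C_u=\{c\in C:\mathrm{wt}(c)=u\}$ where $\mathrm{wt}$ is Hamming weight. *)

(* Defs.v *)
From mathcomp Require Import all_boot all_order all_algebra all_fingroup.
Set Implicit Arguments. Unset Strict Implicit. Unset Printing Implicit Defensive.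
Import GRing.Theory.
Local Open Scope ring_scope.

Definition wt n (x : 'rV['F_2]_n) : nat := #|[set i : 'I_n | x 0 i != 0]|.

Definition is_linear_code n (C : {set 'rV['F_2]_n}) : Prop :=
  0 \in C /\ forall (a : 'F_2) (x y : 'rV['F_2]_n), x \in C -> y \in C -> a *: x + y \in C.

Definition dual_code n (C : {set 'rV['F_2]_n}) : {set 'rV['F_2]_n} :=
  [set x | [forall c in C, (x *m c^T) 0 0 == 0]].

Definition is_min_dist n (D : {set 'rV['F_2]_n}) (d : nat) : Prop :=
  (exists2 x, x \in D & (x != 0) /\ wt x = d) /\
  (forall x, x \in D -> x != 0 -> (d <= wt x)%N).

Definition nb_weights_upto n (C : {set 'rV['F_2]_n}) (t : nat) : nat :=
  #|[set u : 'I_n.+1 | (0 < u <= n - t)%N && [exists c in C, wt c == u]]|.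

(* Extended binary Golay code G24: the extended [23,12,7] quadratic-residue
   (Golay) cyclic code with generator polynomial
   g(x) = 1 + x^2 + x^4 + x^5 + x^6 + x^10 + x^11, plus an overall parity bit.
   Since g has odd weight, every generator row has parity bit 1. *)
Definition golay_g : seq nat := [:: 1; 0; 1; 0; 1; 1; 1; 0; 0; 0; 1; 1]%N.

Definition golay_gen : 'M['F_2]_(12, 24) :=
  \matrix_(i < 12, j < 24)
    (if (nat_of_ord j == 23)%N then 1
     else if (i <= j <= i + 11)%N then (nth 0%N golay_g (j - i))%:R else 0).

Definition G24 : {set 'rV['F_2]_24} := [set m *m golay_gen | m : 'rV['F_2]_12].

Definition code_equiv n m (C : {set 'rV['F_2]_n}) (D : {set 'rV['F_2]_m}) : Prop :=
  exists f : 'I_m -> 'I_n, bijective f /\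
    [set (\row_j (c : 'rV['F_2]_n) 0 (f j)) | c in C] = D.

(* Main.v *)
(* Let s = n - 2 wt and W the set of weights of C. Since the dual has minimum weight 8, C and the
   whole space give the same average to every function of degree at most 7 in the coordinates.

   If C had a word of weight j <= 4, then for a j-set T a polynomial of degree at most 7 - j in the
   weight, applied to the words of C vanishing on T, would detect whether the complement of T is a
   codeword, with an answer independent of T; so all j-sets would be codewords, forcing the dual
   to consist of constant words and n = 8, which is impossible. Hence the three weights in
   (0, n - 5] are d, n/2, n - d. Comparing the averages of s^2 (s^2 - (n - 2d)^2) and
   s^4 (s^2 - (n - 2d)^2) gives (n - 2d)^2 = 3n - 8 and 3 |C| = n (n^2 - 3n + 8); as |C| is a power
   of two, n = 24, d = 8 and |C| = 2^12.

   For uniqueness, fix a dodecad X of C, a point l0 in X and a point r0 outside. For each other l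
   in X there is a unique codeword meeting X in {l, l0} and missing r0; the complements of these
   words outside X are the blocks of a 2-(11,5,2) design (a biplane). Relative to a block, the six
   points off that block correspond to 5-cycles on its five points, pairwise sharing two edges, and
   there are only two such families of six 5-cycles. This gives two explicit generator matrices,
   each a relabelling of that of G24. *)
Require Import Defs.
From mathcomp Require Import all_boot all_order all_algebra all_fingroup.
From mathcomp Require Import zify ring.
Set Implicit Arguments. Unset Strict Implicit. Unset Printing Implicit Defensive.
Import Order.TTheory GRing.Theory Num.Theory.
Local Open Scope ring_scope.

(** * Vectors, characters and designs of strength k *)

Lemma F2P (a : 'F_2) : a = 0 \/ a = 1.
Proof. by case: a => [[|[|m]] lt_m2]; [left; apply: val_inj | right; apply: val_inj | ]. Qed.

Lemma F2_neq0 (a : 'F_2) : a = (a != 0)%:R.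
Proof. by case: (F2P a) => ->. Qed.

Lemma F2_addr_neq0 (a b : 'F_2) : (a + b != 0) = (a != 0) (+) (b != 0).
Proof. by case: (F2P a) (F2P b) => -> [] ->. Qed.

Lemma F2_natr_odd (m : nat) : m%:R = (odd m)%:R :> 'F_2.
Proof.
elim: m => // m IHm; rewrite mulrS IHm /=.
by case: (odd m); apply: val_inj.
Qed.

Lemma F2_natr_eq0 (m : nat) : ((m%:R : 'F_2) == 0) = ~~ odd m.
Proof. by rewrite F2_natr_odd; case: (odd m). Qed.

Lemma natr_card (R : pzSemiRingType) (I : finType) (A : {set I}) :
  #|A|%:R = \sum_i (i \in A)%:R :> R.
Proof.
rewrite -sum1_card natr_sum big_mkcond; apply: eq_bigr => i _.
by case: (i \in A).
Qed.

Section Vectors.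
Variable n : nat.
Implicit Types x y z : 'rV['F_2]_n.

Definition dotp x y : 'F_2 := (x *m y^T) 0 0.

Lemma dotpE x y : dotp x y = \sum_i x 0 i * y 0 i.
Proof. by rewrite /dotp mxE; apply: eq_bigr => i _; rewrite mxE. Qed.

Lemma dotpC x y : dotp x y = dotp y x.
Proof. by rewrite !dotpE; apply: eq_bigr => i _; rewrite mulrC. Qed.

Lemma dotpDl x y z : dotp (x + y) z = dotp x z + dotp y z.
Proof. by rewrite /dotp mulmxDl mxE. Qed.

Lemma dotpDr x y z : dotp x (y + z) = dotp x y + dotp x z.
Proof. by rewrite dotpC dotpDl !(dotpC _ x). Qed.

Lemma dotp0 x : dotp x 0 = 0.
Proof. by rewrite /dotp trmx0 mulmx0 mxE. Qed.

Lemma dotp_delta x i : dotp x (delta_mx 0 i) = x 0 i.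
Proof.
rewrite dotpE (bigD1 i) //= big1 => [|j /negbTE ne_ji]; rewrite !mxE !eqxx ?ne_ji.
  by rewrite mulr1 addr0.
by rewrite andbF mulr0.
Qed.

Lemma F2_addvv x : x + x = 0.
Proof. by apply/rowP => i; rewrite !mxE; case: (F2P (x 0 i)) => ->; apply: val_inj. Qed.

Definition supp x : {set 'I_n} := [set i | x 0 i != 0].

Lemma in_supp x i : (i \in supp x) = (x 0 i != 0).
Proof. by rewrite inE. Qed.

Definition indic (S : {set 'I_n}) : 'rV['F_2]_n := \row_i (i \in S)%:R.

Lemma supp_indic S : supp (indic S) = S.
Proof. by apply/setP => i; rewrite inE mxE; case: (i \in S). Qed.

Lemma indic_supp x : indic (supp x) = x.
Proof. by apply/rowP => i; rewrite mxE inE -F2_neq0. Qed.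

Lemma supp_inj : injective supp.
Proof. exact: can_inj indic_supp. Qed.

Lemma wt_indic S : wt (indic S) = #|S|.
Proof. by rewrite /wt -/(supp _) supp_indic. Qed.

Lemma wtE x : wt x = #|supp x|. Proof. by []. Qed.

Lemma supp0 : supp 0 = set0.
Proof. by apply/setP => i; rewrite !inE mxE eqxx. Qed.

Lemma wt0 : wt (0 : 'rV['F_2]_n) = 0%N.
Proof. by rewrite /wt -/(supp _) supp0 cards0. Qed.

Lemma supp1 : supp (const_mx 1) = setT.
Proof. by apply/setP => i; rewrite !inE mxE. Qed.

Lemma wt1 : wt (const_mx 1 : 'rV['F_2]_n) = n.
Proof. by rewrite /wt -/(supp _) supp1 cardsT card_ord. Qed.

Lemma wt_le x : (wt x <= n)%N.
Proof. by rewrite -[n in (_ <= n)%N]card_ord max_card. Qed.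

Lemma wt_eq0 x : (wt x == 0%N) = (x == 0).
Proof. by rewrite cards_eq0 -/(supp x) -(inj_eq supp_inj) supp0. Qed.

Lemma wt_eqn x : (wt x == n) = (x == const_mx 1).
Proof.
rewrite -(inj_eq supp_inj) supp1 eqEcard subsetT cardsT card_ord /=.
by rewrite eqn_leq wt_le.
Qed.

Lemma wt_delta i : wt (delta_mx 0 i : 'rV['F_2]_n) = 1%N.
Proof.
rewrite -[RHS](cards1 i); apply: eq_card => j.
by rewrite !inE mxE eqxx /=; case: (j == i).
Qed.

Lemma suppD x y : supp (x + y) = (supp x :\: supp y) :|: (supp y :\: supp x).
Proof.
apply/setP => i; rewrite !inE mxE F2_addr_neq0.
by case: (_ != 0); case: (_ != 0).
Qed.

Lemma wtD x y : (wt (x + y) + (#|supp x :&: supp y|).*2 = wt x + wt y)%N.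
Proof.
rewrite !wtE suppD cardsU.
have -> : (supp x :\: supp y) :&: (supp y :\: supp x) = set0.
  by apply/setP => i; rewrite !inE; case: (_ != 0); case: (_ != 0).
rewrite cards0 subn0; have := cardsID (supp y) (supp x); have := cardsID (supp x) (supp y).
by rewrite (setIC (supp y)); lia.
Qed.

Lemma wt_compl x : wt (const_mx 1 + x) = (n - wt x)%N.
Proof.
by have := wtD (const_mx 1) x; rewrite supp1 setTI wt1 !wtE; lia.
Qed.

Lemma wtD_le x y : (wt (x + y) <= wt x + wt y)%N.
Proof. by rewrite -wtD leq_addr. Qed.

Lemma dotp_card x y : dotp x y = (#|supp x :&: supp y|)%:R.
Proof.
rewrite dotpE (eq_bigr (fun i => (i \in supp x :&: supp y)%:R)); last first.
  by move=> i _; rewrite !inE [in LHS](F2_neq0 (x 0 i)) [in LHS](F2_neq0 (y 0 i)) -natrM mulnb.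
by rewrite -natr_card.
Qed.

Lemma dotp_eq0 x y : (dotp x y == 0) = ~~ odd #|supp x :&: supp y|.
Proof. by rewrite dotp_card F2_natr_eq0. Qed.

(** The character $(-1)^{y\cdot x}$, with integer values so that sums over [C] and over the whole
    space can be compared. *)
Definition chi y x : int := if dotp y x == 0 then 1 else -1.

Lemma chiDl y z x : chi (y + z) x = chi y x * chi z x.
Proof. by rewrite /chi dotpDl; case: (F2P (dotp y x)) (F2P (dotp z x)) => -> [] ->. Qed.

Lemma chiDr y x z : chi y (x + z) = chi y x * chi y z.
Proof. by rewrite /chi dotpDr; case: (F2P (dotp y x)) (F2P (dotp y z)) => -> [] ->. Qed.

Lemma chi0 x : chi 0 x = 1.
Proof. by rewrite /chi dotpC dotp0 eqxx. Qed.

Lemma chi_delta i x : chi (delta_mx 0 i) x = if x 0 i == 0 then 1 else -1.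
Proof. by rewrite /chi dotpC dotp_delta. Qed.

(** A coordinate character is 1 off the support and -1 on it. This exhibits n - 2 wt as a function
    of degree one in the characters. *)
Lemma sum_chi_delta x : \sum_i chi (delta_mx 0 i) x = n%:Z - (wt x).*2%:Z.
Proof.
rewrite (eq_bigr (fun i => 1 - (i \in supp x)%:R *+ 2)); last first.
  by move=> i _; rewrite chi_delta inE; case: (_ == 0).
rewrite big_split /= sumr_const card_ord sumrN sumrMnl -natr_card wtE.
by rewrite !natz mulr2n -addnn PoszD.
Qed.

Section Code.
Variable C : {set 'rV['F_2]_n}.
Hypothesis linC : is_linear_code C.

Lemma code0 : 0 \in C. Proof. by case: linC. Qed.

Lemma codeD x y : x \in C -> y \in C -> x + y \in C.
Proof. by move=> Cx Cy; case: linC => _ /(_ 1 x y Cx Cy); rewrite scale1r. Qed.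

Lemma codeDr c x : c \in C -> (x + c \in C) = (x \in C).
Proof.
move=> Cc; apply/idP/idP => [Cxc|/codeD-> //].
by rewrite -(addr0 x) -(F2_addvv c) addrA codeD.
Qed.

Lemma dualP y : reflect (forall c, c \in C -> dotp y c = 0) (y \in dual_code C).
Proof. by rewrite inE; apply: (iffP forall_inP) => D c /D /eqP. Qed.

(** Translation by a codeword not orthogonal to [y] permutes [C] and changes the sign of every
    term. *)
Lemma sum_chi_nondual y : y \notin dual_code C -> \sum_(x in C) chi y x = 0.
Proof.
rewrite inE negb_forall_in => /exists_inP[c Cc nz_yc].
have: \sum_(x in C) chi y x = - \sum_(x in C) chi y x.
  rewrite [LHS](reindex_inj (addIr c)) -sumrN /=.
  apply: eq_big => [x|x _]; first by rewrite codeDr.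
  by rewrite chiDr {2}/chi (negbTE nz_yc) mulrN1.
by lia.
Qed.
End Code.

Lemma linear_setT : is_linear_code [set: 'rV['F_2]_n].
Proof. by split=> *; rewrite inE. Qed.

Section Strength.
Variable C : {set 'rV['F_2]_n}.
Hypothesis linC : is_linear_code C.

(* [f] has degree at most [K - k] when the dual distance of [C] exceeds [K]: multiplying [f] by a
   coordinate character costs one unit of [k]. *)
Definition agree (k : nat) (f : 'rV['F_2]_n -> int) : Prop :=
  forall y, (wt y <= k)%N ->
  (\sum_(x in C) f x * chi y x) * #|{: 'rV['F_2]_n}|%:Z =
  #|C|%:Z * \sum_x f x * chi y x.

Lemma eq_agree k f g : f =1 g -> agree k f -> agree k g.
Proof.
move=> fg fP y /fP; rewrite (eq_bigr _ (fun i _ => congr1 (fun t => t * chi y i) (fg i))).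
by rewrite [in RHS](eq_bigr _ (fun i _ => congr1 (fun t => t * chi y i) (fg i))).
Qed.

(** A nonzero [y] of weight at most [k] is orthogonal neither to all of [C] nor to the whole space,
    so both character sums vanish; for [y = 0] both sums merely count. *)
Lemma agree1 k : (forall x, x \in dual_code C -> x != 0 -> (k < wt x)%N) -> agree k (fun=> 1).
Proof.
move=> dC y wty; have E (P : pred _) : \sum_(x | P x) 1 * chi y x = \sum_(x | P x) chi y x.
  by apply: eq_bigr => x _; rewrite mul1r.
rewrite !E; have [-> | nz_y] := eqVneq y 0.
  rewrite (eq_bigr (fun=> 1)) 1?[X in _ = _ * X](eq_bigr (fun=> 1)); try by move=> ? _; exact: chi0.
  by rewrite !sumr_const !natz.
rewrite sum_chi_nondual //; last by apply/negP => /dC/(_ nz_y); rewrite ltnNge wty.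
rewrite (eq_bigl (mem [set: 'rV['F_2]_n])) => [|x]; last by rewrite /= inE.
rewrite sum_chi_nondual ?mulr0 ?mul0r //; first exact: linear_setT.
move: nz_y; rewrite -wt_eq0 cards_eq0 => /set0Pn[i]; rewrite inE => nz_i.
apply/negP => /dualP/(_ (delta_mx 0 i)); rewrite inE dotp_delta => /(_ isT)/eqP.
by rewrite (negbTE nz_i).
Qed.

Lemma agreeW k m f : (k <= m)%N -> agree m f -> agree k f.
Proof. by move=> le_km fP y le_yk; apply: fP; apply: leq_trans le_km. Qed.

Lemma agreeD k f g : agree k f -> agree k g -> agree k (fun x => f x + g x).
Proof.
move=> fP gP y le_yk; have E (P : pred _) : \sum_(x | P x) (f x + g x) * chi y x =
  \sum_(x | P x) f x * chi y x + \sum_(x | P x) g x * chi y x.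
  by rewrite -big_split /=; apply: eq_bigr => x _; rewrite mulrDl.
by rewrite !E mulrDl mulrDr fP ?gP.
Qed.

Lemma agreeZ k a f : agree k f -> agree k (fun x => a * f x).
Proof.
move=> fP y le_yk; have E (P : pred _) : \sum_(x | P x) (a * f x) * chi y x =
  a * \sum_(x | P x) f x * chi y x.
  by rewrite mulr_sumr; apply: eq_bigr => x _; rewrite mulrA.
by rewrite !E -mulrA fP // mulrCA.
Qed.

Lemma agree_sum k (I : Type) (r : seq I) (F : I -> 'rV['F_2]_n -> int) :
  (forall i, agree k (F i)) -> agree k (fun x => \sum_(i <- r) F i x).
Proof.
move=> FP; elim: r => [|i r IHr].
  apply: (eq_agree (f := fun x => 0 * 0)) => [x|]; first by rewrite big_nil mul0r.
  move=> y _; have E (P : pred 'rV['F_2]_n) : \sum_(x | P x) 0 * 0 * chi y x = 0.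
    by apply: big1 => x _; rewrite !mul0r.
  by rewrite !E mul0r mulr0.
apply: (eq_agree (f := fun x => F i x + \sum_(j <- r) F j x)) => [x|]; first by rewrite big_cons.
exact: agreeD.
Qed.

(** The coordinate character merges with [chi y] into the character of [delta_mx 0 i + y], whose
    weight is larger by at most one. *)
Lemma agree_chi k i f : agree k.+1 f -> agree k (fun x => chi (delta_mx 0 i) x * f x).
Proof.
move=> fP y le_yk.
have E (P : pred _) : \sum_(x | P x) (chi (delta_mx 0 i) x * f x) * chi y x =
  \sum_(x | P x) f x * chi (delta_mx 0 i + y) x.
  by apply: eq_bigr => x _; rewrite chiDl; ring.
rewrite !E; apply: fP; apply: leq_trans (wtD_le _ _) _.
by rewrite wt_delta.
Qed.

Definition cwt x : int := n%:Z - (wt x).*2%:Z.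

Lemma agree_cwt k a f : agree k.+1 f -> agree k (fun x => (cwt x + a) * f x).
Proof.
move=> fP; apply: (eq_agree (f := fun x => \sum_i chi (delta_mx 0 i) x * f x + a * f x)).
  by move=> x; rewrite /cwt -sum_chi_delta -mulr_suml mulrDl.
apply: agreeD; last exact/agreeZ/(agreeW _ fP).
by apply: agree_sum => i; apply: agree_chi.
Qed.

(** [1 + chi (delta_mx 0 i)] is twice the indicator of a zero at [i]; keeping the factor two avoids
    fractions. *)
Lemma agree_coord0 k i f : agree k.+1 f -> agree k (fun x => if x 0 i == 0 then f x *+ 2 else 0).
Proof.
move=> fP; apply: (eq_agree (f := fun x => f x + chi (delta_mx 0 i) x * f x)).
  by move=> x; rewrite chi_delta; case: (_ == 0); ring.
by apply: agreeD; [exact: agreeW fP | exact: agree_chi].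
Qed.

Lemma agreeE f : agree 0 f -> (\sum_(x in C) f x) * #|{: 'rV['F_2]_n}|%:Z = #|C|%:Z * \sum_x f x.
Proof.
move/(_ 0); rewrite wt0 => /(_ isT).
have E (P : pred _) : \sum_(x | P x) f x * chi 0 x = \sum_(x | P x) f x.
  by apply: eq_bigr => x _; rewrite chi0 mulr1.
by rewrite !E.
Qed.
End Strength.
End Vectors.

(** * Moments of the weight *)

Lemma cwtE n (x : 'rV['F_2]_n) : cwt x = \sum_i (if x 0 i == 0 then 1 else -1).
Proof. by rewrite /cwt -sum_chi_delta; apply: eq_bigr => i _; rewrite chi_delta. Qed.

Lemma sum_cwtS n (f : int -> int) :
  \sum_(x : 'rV['F_2]_n.+1) f (cwt x) = \sum_(x : 'rV['F_2]_n) (f (cwt x + 1) + f (cwt x - 1)).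
Proof.
pose h (p : 'F_2 * 'rV['F_2]_n) : 'rV['F_2]_(1 + n) := row_mx (const_mx p.1) p.2.
have h_bij : bijective h.
  exists (fun x : 'rV['F_2]_(1 + n) => (lsubmx x 0 0, rsubmx x)) => [[a x] | x].
    by rewrite /h row_mxKl row_mxKr mxE.
  rewrite /h -[RHS]hsubmxK; congr row_mx.
  by apply/rowP => i; rewrite !mxE (ord1 i).
rewrite (reindex h) /=; last exact: onW_bij.
have cwt_h p : cwt (h p) = cwt p.2 + (if p.1 == 0 then 1 else -1).
  rewrite !cwtE big_split_ord /= big_ord1 row_mxEl mxE addrC; congr (_ + _).
  by apply: eq_bigr => i _; rewrite row_mxEr.
rewrite (eq_bigr (fun p => f (cwt p.2 + (if p.1 == 0 then 1 else -1)))); last by move=> p _;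
  rewrite cwt_h.
rewrite -(pair_bigA _ (fun (a : 'F_2) x => f (cwt x + (if a == 0 then 1 else -1)))) /=.
rewrite exchange_big; apply: eq_bigr => x _.
by rewrite big_ord_recl big_ord1.
Qed.

Lemma card_rowS n : #|{: 'rV['F_2]_n.+1}|%:Z = 2 * #|{: 'rV['F_2]_n}|%:Z.
Proof. by rewrite !card_mx !mul1n card_Fp // expnS PoszM. Qed.

(** These are the moments of a walk of n independent steps 1 or -1, found by induction on n from the
    expansion of $(s+1)^m+(s-1)^m$. *)
Lemma sum_cwt_even_powers n (q := #|{: 'rV['F_2]_n}|%:Z) :
  [/\ \sum_(x : 'rV['F_2]_n) cwt x ^+ 2 = q * n%:Z,
      \sum_(x : 'rV['F_2]_n) cwt x ^+ 4 = q * (3 * n%:Z ^+ 2 - 2 * n%:Z) &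
      \sum_(x : 'rV['F_2]_n) cwt x ^+ 6 = q * (15 * n%:Z ^+ 3 - 30 * n%:Z ^+ 2 + 16 * n%:Z)].
Proof.
rewrite {}/q; elim: n => [|n [IH2 IH4 IH6]].
  have E k : \sum_(x : 'rV['F_2]_0) cwt x ^+ k.+1 = 0.
    by apply: big1 => x _; rewrite cwtE big_ord0 expr0n.
  by rewrite !E; split; ring.
rewrite card_rowS (sum_cwtS _ (fun s => s ^+ 2)) (sum_cwtS _ (fun s =>
  s ^+ 4)) (sum_cwtS _ (fun s => s ^+ 6)).
have E1 : \sum_(x : 'rV['F_2]_n) (1 : int) = #|{: 'rV['F_2]_n}|%:Z by rewrite sumr_const natz.
split.
- rewrite (eq_bigr (fun x => 2 * cwt x ^+ 2 + 2 * 1)) => [|x _]; last by ring.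
  by rewrite big_split /= -!mulr_sumr IH2 E1 -natr1; ring.
- rewrite (eq_bigr (fun x => (2 * cwt x ^+ 4 + 12 * cwt x ^+ 2) + 2 * 1)) => [|x _]; last by ring.
  by rewrite !big_split /= -!mulr_sumr IH2 IH4 E1 -natr1; ring.
- rewrite (eq_bigr (fun x => ((2 * cwt x ^+ 6 + 30 * cwt x ^+ 4) + 30 * cwt x ^+ 2) + 2 * 1)) =>
  [|x _]; last by ring.
  by rewrite !big_split /= -!mulr_sumr IH2 IH4 IH6 E1 -natr1; ring.
Qed.

Lemma card_row_neq0 n : #|{: 'rV['F_2]_n}|%:Z != 0.
Proof. by rewrite card_mx card_Fp // mul1n; have := expn_gt0 2 n; lia. Qed.

(** * Codewords vanishing on a set of coordinates *)

Section Strength7.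
Variables (n : nat) (C : {set 'rV['F_2]_n}).
Hypothesis linC : is_linear_code C.
Hypothesis dC : forall x, x \in dual_code C -> x != 0 -> (7 < wt x)%N.
Implicit Types (T : {set 'I_n}) (U : seq nat) (x : 'rV['F_2]_n).

Lemma agree_prod_cwt k (U : seq int) : (k + size U <= 7)%N ->
  agree C k (fun x => \prod_(a <- U) (cwt x + a)).
Proof.
elim: U k => [|a U IHU] k leU.
  apply: (@eq_agree _ C k (fun=> 1)) => [x|]; first by rewrite big_nil.
  by apply: agree1 => // x Dx /(dC Dx); apply: leq_ltn_trans; rewrite addn0 in leU.
apply: (@eq_agree _ C k (fun x => (cwt x + a) * \prod_(b <- U) (cwt x + b))) => [x|].
  by rewrite big_cons.
by apply: agree_cwt; apply: IHU; rewrite addSnnS.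
Qed.

Lemma agree_vanishing k (s : seq 'I_n) (f : 'rV['F_2]_n -> int) : agree C (k + size s) f ->
  agree C k (fun x => if all (fun i => x 0 i == 0) s then f x *+ 2 ^ size s else 0).
Proof.
elim: s k => [|i s IHs] k fP.
  by apply: (@eq_agree _ C k f) => [x|]; [rewrite mulr1n | rewrite addn0 in fP].
apply: eq_agree (agree_coord0 i (IHs k.+1 _)); last by rewrite addSnnS.
move=> x /=; case: (x 0 i == 0) => //=; case: (all _ _); last by rewrite mul0rn.
by rewrite -mulrnA -expnSr.
Qed.

Lemma disjoint_suppP T x : reflect {in T, forall i, x 0 i = 0} [disjoint T & supp x].
Proof.
rewrite disjoints_subset; apply: (iffP subsetP) => dis i /dis.
  by rewrite !inE negbK => /eqP.
by rewrite !inE => ->; rewrite eqxx.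
Qed.

(** The factor of [u] equals $2(u-\mathrm{wt}(x))$, so it vanishes exactly at weight [u]. The power
    of two is the one accumulated by [agree_vanishing]. *)
Definition shortened_prod (U : seq nat) (T : {set 'I_n}) (x : 'rV['F_2]_n) : int :=
  if [disjoint T & supp x] then (\prod_(u <- U) (cwt x + (u.*2%:Z - n%:Z))) *+ 2 ^ #|T| else 0.

Lemma agree_shortened_prod U T : (#|T| + size U <= 7)%N -> agree C 0 (shortened_prod U T).
Proof.
move=> leTU; have := @agree_prod_cwt #|T| [seq u.*2%:Z - n%:Z | u <- U].
rewrite size_map [#|T|]cardE => /(_ _)/(@agree_vanishing 0 (enum T)).
rewrite -cardE => /(_ leTU); apply: eq_agree => x; rewrite /shortened_prod big_map.
congr (if _ then _ else _); apply/allP/disjoint_suppP => [sT i iT | dis i].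
  by apply/eqP/sT; rewrite mem_enum.
by rewrite mem_enum => /dis ->.
Qed.

Lemma wt_col_perm (g : 'S_n) x : wt (col_perm g x) = wt (x : 'rV['F_2]_n).
Proof.
rewrite !wtE -(card_imset _ (@perm_inj _ g)); apply: eq_card => i.
apply/imsetP/idP => [[j] | xi]; first by rewrite !inE mxE => xj ->.
by exists (g^-1 i)%g; rewrite ?permKV // in_supp mxE permKV -in_supp.
Qed.

Lemma shortened_prod_perm U T (g : 'S_n) x :
  shortened_prod U (g @: T) x = shortened_prod U T (col_perm g x).
Proof.
rewrite /shortened_prod /cwt wt_col_perm card_imset; last exact: perm_inj.
congr (if _ then _ else _); apply/disjoint_suppP/disjoint_suppP => dis i.
  by move=> iT; rewrite mxE dis ?imset_f.
by case/imsetP => j /dis; rewrite mxE => xj ->.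
Qed.

(** A codeword vanishing on [T] is zero, or the indicator of the complement of [T], or has a smaller
    nonzero weight and is killed by a root in [U]. The two summands are the values at the first two
    words. *)
Lemma sum_shortened_prod U T :
  (#|T| < n)%N -> (forall c, c \in C -> wt c != 0%N -> (wt c < n - #|T|)%N -> wt c \in U) ->
  \sum_(c in C) shortened_prod U T c =
    (\prod_(u <- U) u.*2%:Z) *+ 2 ^ #|T| +
    (if indic (~: T) \in C then (\prod_(u <- U) ((#|T|.*2%:Z - n%:Z) + (u.*2%:Z - n%:Z))) *+ 2 ^ #|T| else 0).
Proof.
move=> ltTn Uwt; have dis0 : [disjoint T & supp (0 : 'rV['F_2]_n)] by rewrite supp0 disjoints_subset setC0 subsetT.
rewrite (bigD1 0) ?code0 //=; congr (_ + _).
  rewrite /shortened_prod dis0; congr (_ *+ _); apply: eq_bigr => u _.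
  by rewrite /cwt wt0 double0; ring.
have nz : indic (~: T) != 0.
  by rewrite -wt_eq0 wt_indic cardsCs setCK card_ord; lia.
have other c : c \in C -> c != 0 -> c != indic (~: T) -> shortened_prod U T c = 0.
  move=> Cc nz_c ne_c; rewrite /shortened_prod; case: ifP => // dis.
  have sub : supp c \subset ~: T by rewrite -disjoints_subset disjoint_sym.
  have : (wt c < n - #|T|)%N.
    have: supp c \proper ~: T.
      rewrite properEneq sub andbT; apply: contra ne_c => /eqP <-.
      by rewrite indic_supp.
    by move/proper_card; rewrite [#|~: T|]cardsCs setCK card_ord.
  move/(Uwt c Cc); rewrite wt_eq0 => /(_ nz_c) Uc.
  rewrite (big_rem _ Uc) /= [X in X * _](_ : _ = 0) ?mul0r ?mul0rn //.
  by rewrite /cwt; ring.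
case: ifP => Ci.
  rewrite (bigD1 (indic (~: T))) /=; last by rewrite Ci.
  rewrite big1 ?addr0 => [|c /andP[/andP[Cc nz_c] ne_c]]; last exact: other.
  rewrite /shortened_prod supp_indic disjoints_subset setCK subxx; congr (_ *+ _).
  apply: eq_bigr => u _; congr (_ + _); rewrite /cwt wt_indic [#|~: T|]cardsCs setCK card_ord.
  by move: ltTn; move: #|_| => m; lia.
apply: big1 => c /andP[Cc nz_c]; apply: other => //.
by apply: contraFneq Ci => <-.
Qed.

(* Among the codewords vanishing on [T], the polynomial in the weight with roots [U] detects the
   complement of [T]; its sum over [C] equals a sum over the whole space,
     which is symmetric in [T]. *)
Lemma code_indic_perm U T (g : 'S_n) :
  (#|T| < n)%N -> (#|T| + size U <= 7)%N -> all (fun u => u < n - #|T|)%N U ->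
  (forall c, c \in C -> wt c != 0%N -> (wt c < n - #|T|)%N -> wt c \in U) ->
  indic (~: T) \in C -> indic (~: (g @: T)) \in C.
Proof.
move=> ltTn leTU ltU Uwt CT.
have cardg : #|g @: T| = #|T| by apply: card_imset; exact: perm_inj.
have := agreeE (agree_shortened_prod leTU).
have := agree_shortened_prod (U := U) (T := g @: T); rewrite cardg => /(_ leTU)/agreeE.
have col_perm_inj : injective (@col_perm 'F_2 1 n g).
  by move=> x y /(congr1 (col_perm g^-1)); rewrite -!col_permM mulVg !col_perm1.
rewrite [X in _ = _ * X](_ : _ = \sum_x shortened_prod U T x); last first.
  rewrite [RHS](reindex_inj col_perm_inj) /=.
  by apply: eq_bigr => x _; exact: shortened_prod_perm.
move=> Eg /esym; rewrite -Eg => /(mulIf (card_row_neq0 n)).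
rewrite !sum_shortened_prod ?cardg // CT; case: ifP => // _ /eqP.
(* If the moved indicator were not in [C], the extra term for [T] would be zero, so some [u] in [U]
   would equal [n - #|T|], which [ltU] excludes. *)
rewrite (inj_eq (addrI _)) eq_sym => /eqP/eqP.
rewrite mulrn_eq0 expn_eq0 /= prodf_seq_eq0 => /hasP[u /(allP ltU)] /=.
by lia.
Qed.
End Strength7.

(** * Length, size and weights of the code *)

(** Both [n] and [p] divide $3\cdot 2^k$, so their odd divisors are at most 3. If $n=16h$, then [p]
    has the odd divisor $32h^2-6h+1>3$. Otherwise [n] is 1 or 3 times a divisor of 8, and [n > 8]
    leaves 12 and 24. *)
Lemma golay_length n k : (8 < n)%N -> (3 * 2 ^ k = n * (n ^ 2 - 3 * n + 8))%N -> n = 24%N.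
Proof.
move=> n8; set p := (n ^ 2 - 3 * n + 8)%N => eq_np.
have odd_dvd q : odd q -> (q %| 3 * 2 ^ k)%N -> (q <= 3)%N.
  move=> odd_q; rewrite Gauss_dvdl; last by rewrite coprimeXr // coprimen2.
  exact: dvdn_leq.
have n_dvd : (n %| 3 * 2 ^ k)%N by rewrite eq_np dvdn_mulr.
have p_dvd : (p %| 3 * 2 ^ k)%N by rewrite eq_np dvdn_mull.
have [n16 | n16] := boolP (16 %| n)%N.
  have [h def_n] := dvdnP n16; have h0 : (0 < h)%N by lia.
  have le_hh : (h <= h * h)%N by rewrite leq_pmulr.
  have def_p : p = ((32 * (h * h) + 1 - 6 * h) * 8)%N.
    by rewrite /p def_n -mulnn mulnACA; lia.
  have := odd_dvd (32 * (h * h) + 1 - 6 * h)%N.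
  have -> : odd (32 * (h * h) + 1 - 6 * h) by lia.
  have -> : (32 * (h * h) + 1 - 6 * h %| 3 * 2 ^ k)%N.
    by apply: dvdn_trans p_dvd; rewrite def_p dvdn_mulr.
  by move=> /(_ isT isT); lia.
have [m odd_m def_n] : exists2 m, odd m & [|| n == m, n == m * 2, n == m * 4 | n == m * 8]%N.
  have [o1|o1] := boolP (odd n); first by exists n; rewrite ?eqxx.
  have [o2|o2] := boolP (odd (n %/ 2)); first by exists (n %/ 2)%N => //; lia.
  have [o3|o3] := boolP (odd (n %/ 4)); first by exists (n %/ 4)%N => //; lia.
  by exists (n %/ 8)%N; lia.
have m3 : (m <= 3)%N.
  apply: odd_dvd => //; apply: dvdn_trans n_dvd.
  by case/or4P: def_n => /eqP->; rewrite ?dvdnn ?dvdn_mulr.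
have [-> // | n12] : n = 24%N \/ n = 12%N by lia.
(* Length 12 would require $2^k=464$, strictly between $2^8$ and $2^9$. *)
move: eq_np; rewrite /p n12 => eq_k.
have [le_k8 | lt_8k] := leqP k 8.
  have : (2 ^ k <= 2 ^ 8)%N by rewrite leq_exp2l.
  by move: eq_k; lia.
have : (2 ^ 9 <= 2 ^ k)%N by rewrite leq_exp2l.
by move: eq_k; lia.
Qed.

(** The involution $u\mapsto n-u$ on three elements fixes one, necessarily n/2, and swaps the other
    two. The lower bounds keep truncated subtraction from interfering. *)
Lemma involution3 (n x y z : nat) :
  uniq [:: x; y; z] -> (4 < x)%N -> (4 < y)%N -> (4 < z)%N ->
  [|| n - x == x, n - x == y | n - x == z]%N -> [|| n - y == x, n - y == y | n - y == z]%N ->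
  [|| n - z == x, n - z == y | n - z == z]%N ->
  (n = x.*2 /\ n = y + z \/ n = y.*2 /\ n = x + z \/ n = z.*2 /\ n = x + y)%N.
Proof.
rewrite /= !inE andbT => /andP[/norP[/eqP nxy /eqP nxz] /eqP nyz] x4 y4 z4.
by case/or3P=> /eqP ex; case/or3P=> /eqP ey; case/or3P=> /eqP ez;
  first [left; split; lia | right; left; split; lia | right; right; split; lia | exfalso; lia].
Qed.

Section WeightEnumeration.
Variables (n : nat) (C : {set 'rV['F_2]_n}).
Hypotheses (linC : is_linear_code C) (C1 : const_mx 1 \in C).
Hypothesis dC : forall x, x \in dual_code C -> x != 0 -> (7 < wt x)%N.
Variable w8 : 'rV['F_2]_n.
Hypotheses (Dw8 : w8 \in dual_code C) (wt_w8 : wt w8 = 8%N).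
Hypothesis card_weights : nb_weights_upto C 5 = 3%N.

Let Wset : {set 'I_n.+1} := [set u : 'I_n.+1 | (0 < u <= n - 5)%N && [exists c in C, wt c == u]].

(** For [n = 8] the dual word [w8] is the all-ones vector, so codewords have even weight; the range
    from 1 to 3 then contains only the weight 2, not three weights. *)
Lemma length_gt8 : (8 < n)%N.
Proof.
have le8n : (8 <= n)%N by rewrite -wt_w8 wt_le.
rewrite ltn_neqAle le8n andbT; apply/eqP => n8.
have w8_1 : w8 = const_mx 1 by apply/eqP; rewrite -wt_eqn wt_w8 n8.
have : (#|Wset| <= 1)%N; last by rewrite [#|_|]card_weights.
apply/card_le1_eqP => u v; rewrite !inE.
have E (z : 'I_n.+1) : (0 < z <= n - 5)%N && [exists c in C, wt c == z] -> z = 2 :> nat.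
  case/andP=> le_z /exists_inP[c Cc /eqP wtc].
  have /dualP/(_ c Cc)/eqP := Dw8; rewrite dotp_eq0 w8_1 supp1 setTI -wtE wtc.
  by case: (nat_of_ord z) le_z => [|[|[|[]]]] //; rewrite -n8 //=; lia.
by move=> /E uE /E vE; apply: val_inj; rewrite /= uE vE.
Qed.

(** By [code_indic_perm] the support of a light codeword may be moved by any transposition across
    its boundary, and orthogonality to the resulting codewords makes [w8] constant. *)
Lemma weight_gt4 c : c \in C -> c != 0 -> (4 < wt c)%N.
Proof.
move=> Cc nz_c; rewrite ltnNge; apply/negP => le4.
have n8 := length_gt8; pose T := supp c.
have cardT : #|T| = wt c by [].
have wt_gt0 : (0 < wt c)%N by rewrite lt0n wt_eq0.
have compl_indic S : (indic (~: S) \in C) = (indic S \in C).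
  rewrite -(codeDr linC _ C1); congr (_ \in C); apply: supp_inj.
  rewrite suppD !supp_indic supp1 setTD setCK.
  by apply/setP => i; rewrite !inE; case: (i \in S).
pose U := [seq u <- iota 1 (n - wt c).-1 | [exists c in C, wt c == u]].
have sizeU : (#|T| + size U <= 7)%N.
  (* Three weights are at most n - 5, and at most 4 - wt c further ones lie between n - 4 and n - wt
     c - 1; adding [#|T|] gives exactly 7. *)
  pose V := map val (enum Wset) ++ iota (n - 4) (4 - wt c).
  have: {subset U <= V}.
    move=> u; rewrite mem_filter mem_iota mem_cat => /andP[Wu ltu].
    have ltun : (u < n.+1)%N by lia.
    case: (leqP u (n - 5)) => leu; apply/orP; [left | right]; last by rewrite mem_iota; lia.
    apply/mapP; exists (Ordinal ltun); rewrite // mem_enum inE /= Wu andbT.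
    by lia.
  move/uniq_leq_size; rewrite filter_uniq ?iota_uniq // size_cat size_map -cardE size_iota.
  by rewrite [#|_|]card_weights cardT => /(_ isT); lia.
have CT : indic (~: T) \in C by rewrite compl_indic indic_supp.
(* The support and its image under the transposition of [a] and [b] differ in these two coordinates
   only, so [w8] is orthogonal to their sum. *)
have swap a b : a \in T -> b \notin T -> w8 0 a = w8 0 b.
  move=> aT bT; have ltT : (#|T| < n)%N by rewrite cardT; lia.
  have ltU : all (fun u => u < n - #|T|)%N U.
    by apply/allP => u; rewrite mem_filter mem_iota cardT; lia.
  have inU x : x \in C -> wt x != 0%N -> (wt x < n - #|T|)%N -> wt x \in U.
    move=> Cx nz_x ltx; rewrite mem_filter mem_iota.
    by apply/andP; split; [apply/exists_inP; exists x | move: ltx; rewrite cardT; lia].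
  have := @code_indic_perm n C linC dC U T (tperm a b) ltT sizeU ltU inU CT.
  rewrite compl_indic.
  move=> Cg; have /dualP Dw := Dw8.
  have := Dw _ (codeD linC Cc Cg); rewrite -(indic_supp c) -/T.
  have -> : indic T + indic (tperm a b @: T) = delta_mx 0 a + delta_mx 0 b.
    apply/rowP => i; rewrite !mxE eqxx /= -{2}(tpermK a b i) mem_imset; last exact: perm_inj.
    have ne_ab : a != b by apply: contraNneq bT => <-.
    case: tpermP => [-> | -> | /eqP/negbTE-> /eqP/negbTE->].
    - by rewrite aT (negbTE bT) eqxx (negbTE ne_ab).
    - by rewrite aT (negbTE bT) eqxx [b == a]eq_sym (negbTE ne_ab) addrC.
    - by case: (i \in T); apply: val_inj.
  rewrite dotpDr !dotp_delta.
  by case: (F2P (w8 0 a)) (F2P (w8 0 b)) => -> [] ->.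
have [a aT] : exists a, a \in T by apply/set0Pn; rewrite -card_gt0 cardT.
have [b bT] : exists b, b \in ~: T by apply/set0Pn;
  rewrite -card_gt0 cardsCs setCK card_ord cardT; lia.
rewrite inE in bT.
have cst i : w8 0 i = w8 0 a.
  by case: (boolP (i \in T)) => iT; [rewrite (swap i b) // (swap a b) | rewrite (swap a i)].
have : w8 = const_mx (w8 0 a) by apply/rowP => i; rewrite mxE.
case: (F2P (w8 0 a)) => -> E; have := wt_w8; rewrite E.
  by rewrite (_ : const_mx 0 = 0) ?wt0 //; apply/rowP => i; rewrite !mxE.
by rewrite wt1; lia.
Qed.

Lemma weight_symmetry c : c \in C -> exists2 c', c' \in C & wt c' = (n - wt c)%N.
Proof. by move=> Cc; exists (const_mx 1 + c); rewrite ?codeD // wt_compl. Qed.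

(** Adding the all-ones word turns weight u into n - u. As nonzero weights exceed 4, the three
    weights up to n - 5 are closed under this involution and [involution3] applies. *)
Lemma weights_shape : exists d, [/\ (0 < d)%N, (2 * d < n)%N, ~~ odd n,
  forall c, c \in C -> c != 0 -> c != const_mx 1 -> [|| wt c == d,
    (wt c).*2 == n | wt c == n - d]%N &
  exists2 c, c \in C & (wt c).*2 = n].
Proof.
have n8 := length_gt8.
pose W := [seq val u | u <- enum Wset].
have memW u : (u \in W) = (0 < u <= n - 5)%N && [exists c in C, wt c == u].
  apply/mapP/idP => [[v] | /andP[ltu Wu]]; first by rewrite mem_enum inE => Wv ->.
  have ltun : (u < n.+1)%N by lia.
  by exists (Ordinal ltun); rewrite // mem_enum inE /= ltu.
have symW u : u \in W -> (4 < u)%N && ((n - u)%N \in W).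
  rewrite !memW => /andP[ltu /exists_inP[c Cc /eqP wtc]].
  have lt4u : (4 < u)%N by rewrite -wtc weight_gt4 // -wt_eq0 wtc; lia.
  rewrite lt4u /=; apply/andP; split; first by lia.
  by have [c' Cc' wtc'] := weight_symmetry Cc; apply/exists_inP; exists c'; rewrite // wtc' wtc.
have uniqW : uniq W by rewrite map_inj_uniq ?enum_uniq //; exact: val_inj.
have sizeW : size W = 3%N by rewrite size_map -cardE [#|_|]card_weights.
have inW c : c \in C -> c != 0 -> c != const_mx 1 -> wt c \in W.
  move=> Cc nz_c n1_c; rewrite memW; apply/andP; split; last by apply/exists_inP; exists c.
  have := weight_gt4 Cc nz_c; have [c' Cc' wtc'] := weight_symmetry Cc.
  have : c' != 0.
    rewrite -wt_eq0 wtc' subn_eq0 -ltnNge ltn_neqAle wt_le andbT.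
    by rewrite wt_eqn.
  by move/(weight_gt4 Cc'); rewrite wtc'; lia.
have halfW : forall m, m \in W -> m.*2 = n -> exists2 c, c \in C & (wt c).*2 = n.
  by move=> m; rewrite memW => /andP[_ /exists_inP[c Cc /eqP wtc]] mn; exists c; rewrite ?wtc.
case: W sizeW uniqW symW inW halfW {memW} => [|x [|y [|z []]]] // _ uniqW symW inW halfW.
have /andP[x4] := symW x ltac:(by rewrite !inE eqxx).
have /andP[y4] := symW y ltac:(by rewrite !inE eqxx orbT).
have /andP[z4] := symW z ltac:(by rewrite !inE eqxx !orbT).
have := halfW x ltac:(by rewrite !inE eqxx).
have := halfW y ltac:(by rewrite !inE eqxx orbT).
have := halfW z ltac:(by rewrite !inE eqxx !orbT).
move: uniqW; rewrite !inE => uniqW hz hy hx sz sy sx.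
have [d [m [d0 m2 dn Wdm hm]]] : exists d m, [/\ (0 < d)%N, (m.*2 = n)%N, (2 * d < n)%N,
    forall u, u \in [:: x; y; z] -> [|| u == d, u == m | u == n - d]%N &
    exists2 c, c \in C & (wt c).*2 = n].
  have [nxy nxz nyz] : [/\ x <> y, x <> z & y <> z].
    by move: uniqW; rewrite /= !inE andbT => /andP[/norP[/eqP ? /eqP ?] /eqP ?].
  have [E | [E | E]] := involution3 uniqW x4 y4 z4 sx sy sz;
    move=> {sx sy sz uniqW symW inW}.
  - exists (minn y z), x; split; try lia; last by apply: hx; lia.
    by move=> u; rewrite !inE => /or3P[] /eqP->; lia.
  - exists (minn x z), y; split; try lia; last by apply: hy; lia.
    by move=> u; rewrite !inE => /or3P[] /eqP->; lia.
  - exists (minn x y), z; split; try lia; last by apply: hz; lia.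
    by move=> u; rewrite !inE => /or3P[] /eqP->; lia.
exists d; split=> //; first by rewrite -m2 odd_double.
by move=> c Cc nz_c n1_c; have := Wdm _ (inW c Cc nz_c n1_c); lia.
Qed.

Lemma card_code_dvd : exists k, #|C| = (2 ^ k)%N.
Proof.
have grC : group_set C.
  by apply/group_setP; split; [exact: code0 | move=> x y; exact: codeD].
have := cardSg (G := [set: 'rV['F_2]_n]%G) (H := Group grC) (subsetT _).
rewrite /= cardsT card_mx card_Fp // mul1n.
by case/(dvdn_pfactor _ _ (isT : prime 2)) => k _ ->; exists k.
Qed.

Lemma moment_equations : exists d, [/\ (2 * d < n)%N, ~~ odd n,
  forall c, c \in C -> c != 0 -> c != const_mx 1 -> [|| wt c == d,
    (wt c).*2 == n | wt c == n - d]%N,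
  exists2 c, c \in C & (wt c).*2 = n &
  (n%:Z - d.*2%:Z) ^+ 2 = 3 * n%:Z - 8 /\ 3 * #|C|%:Z = n%:Z * (n%:Z ^+ 2 - 3 * n%:Z + 8)].
Proof.
have n8 := length_gt8; have [d [d0 dn n_even shape half]] := weights_shape.
exists d; split=> //; set e := n%:Z - d.*2%:Z.
have q0 := card_row_neq0 n; have [E2 E4 E6] := sum_cwt_even_powers n.
(* The two factors with [e] cost two units of strength and [cwt x ^+ k] costs [k], at most 7 in
   total. *)
have ag k : (k <= 5)%N -> agree C 0 (fun x => cwt x ^+ k * ((cwt x + e) * ((cwt x - e) * 1))).
  have : agree C 5 (fun x => (cwt x + e) * ((cwt x - e) * 1)).
    apply: agree_cwt; apply: agree_cwt; exact: agree1.
  move=> ag5 le5; apply: (agreeW (m := 5 - k)) => //.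
  elim: k le5 => [|k IHk] le5; first by apply: eq_agree ag5 => x; rewrite expr0 mul1r.
  have := IHk (ltnW le5); rewrite -(subnSK le5) => /(@agree_cwt n C _ 0).
  by apply: eq_agree => x; rewrite addr0 mulrA -exprS.
(* The factors vanish at the weights d, n/2 and n - d, so only the zero and all-ones words
   contribute. *)
have sumC k : (0 < k)%N -> \sum_(x in C) cwt x ^+ k.*2 * ((cwt x + e) * ((cwt x - e) * 1)) =
  2 * n%:Z ^+ k.*2 * (n%:Z ^+ 2 - e ^+ 2).
  move=> k0; rewrite (bigD1 0) ?code0 //= (bigD1 (const_mx 1)) /=; last first.
    by rewrite C1 -wt_eq0 wt1; lia.
  rewrite big1 => [|x /andP[/andP[Cx nz_x] n1_x]].
    have -> : cwt (const_mx 1 : 'rV['F_2]_n) = - n%:Z by rewrite /cwt wt1; lia.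
    have -> : cwt (0 : 'rV['F_2]_n) = n%:Z by rewrite /cwt wt0; lia.
    by rewrite -!mul2n !exprM sqrrN; ring.
  case/or3P: (shape x Cx nz_x n1_x) => /eqP E.
  - by rewrite /e /cwt E; ring.
  - by rewrite /cwt E subrr expr0n; case: (k) k0 => // k' _; rewrite mul0r.
  - by rewrite [X in _ * (X * _)](_ : _ = 0) ?mul0r ?mulr0 // /e /cwt E; lia.
have expand k : \sum_(x : 'rV['F_2]_n) cwt x ^+ k * ((cwt x + e) * ((cwt x - e) * 1)) =
  \sum_(x : 'rV['F_2]_n) cwt x ^+ k.+2 - e ^+ 2 * \sum_(x : 'rV['F_2]_n) cwt x ^+ k.
  rewrite mulr_sumr -sumrB; apply: eq_bigr => x _.
  by rewrite !exprS; ring.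
have := agreeE (ag 4 isT); have := agreeE (ag 2 isT).
rewrite (sumC 1%N) // (sumC 2) // !expand E2 E4 E6.
move: q0; set q := _%:Z; set K := #|C|%:Z; set N := n%:Z => q0.
have N8 : 8 < N by rewrite /N; lia.
move=> eq2 eq4.
have {}eq2 : 2 * N ^+ 2 * (N ^+ 2 - e ^+ 2) = K * (3 * N ^+ 2 - 2 * N - e ^+ 2 * N).
  by apply: (mulIf q0); rewrite [LHS]eq2; ring.
have {}eq4 : 2 * N ^+ 4 * (N ^+ 2 - e ^+ 2) =
  K * (15 * N ^+ 3 - 30 * N ^+ 2 + 16 * N - e ^+ 2 * (3 * N ^+ 2 - 2 * N)).
  by apply: (mulIf q0); rewrite [LHS]eq4; ring.
have K0 : K != 0 by rewrite /K eqz_nat cards_eq0; apply/set0Pn; exists 0; exact: code0.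
have eqe : e ^+ 2 = 3 * N - 8.
  (* Subtracting $N^2$ times [eq2] from [eq4] cancels the left sides, and the remaining right side
     factors in this way. *)
  have : (K * N * (N - 1) * (N - 2)) * (e ^+ 2 - (3 * N - 8)) = 0.
    have -> : (K * N * (N - 1) * (N - 2)) * (e ^+ 2 - (3 * N - 8)) =
      K * (15 * N ^+ 3 - 30 * N ^+ 2 + 16 * N - e ^+ 2 * (3 * N ^+ 2 - 2 * N)) - N ^+ 2 * (K * (3 * N ^+ 2 - 2 * N - e ^+ 2 * N)) by ring.
    by rewrite -eq2 -eq4; ring.
  move/eqP; rewrite !mulf_eq0 (negbTE K0) /= => /orP[|]; last by rewrite subr_eq0 => /eqP.
  by lia.
split=> //; have N0 : 2 * N != 0 by lia.
apply: (mulIf N0); move: eq2; rewrite eqe => eq2.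
have -> : 3 * K * (2 * N) = K * (3 * N ^+ 2 - 2 * N - (3 * N - 8) * N) by ring.
by rewrite -eq2; ring.
Qed.

(** At length 24 the equations read $(24-2d)^2=64$ and $3|C|=24\cdot 512$, and [2 * d < n] selects d
    = 8. *)
Lemma golay_parameters : [/\ n = 24%N, #|C| = (2 ^ 12)%N,
  forall c, c \in C -> wt c \in [:: 0; 8; 12; 16; 24]%N & exists2 c, c \in C & wt c = 12%N].
Proof.
have n8 := length_gt8; have [d [dn n_even shape half [eqd eqK]]] := moment_equations.
have [k cardC] := card_code_dvd.
have n24 : n = 24%N.
  apply: (@golay_length n k n8).
  have le3n : (3 * n <= n ^ 2)%N by rewrite expnS expn1 leq_mul2r; lia.
  move: eqK; rewrite cardC => eqK; apply/eqP; rewrite -eqz_nat !PoszM PoszD -subzn // PoszM eqK.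
  by rewrite expnS expn1 PoszM; apply/eqP; ring.
subst n; move: eqd eqK => eqd eqK; have d8 : d = 8 by nia.
split.
- by [].
- by apply/eqP; rewrite -eqz_nat; lia.
- move=> c Cc; have [-> | nz_c] := eqVneq c 0; first by rewrite wt0.
  have [-> | n1_c] := eqVneq c (const_mx 1); first by rewrite wt1.
  by have := shape c Cc nz_c n1_c; rewrite d8 !inE; lia.
- by have [c Cc wtc] := half; exists c => //; lia.
Qed.

End WeightEnumeration.

(** * Dodecads and biplanes *)

Lemma code_sum n (C : {set 'rV['F_2]_n}) (I : finType) (a : I -> 'F_2) (F : I -> 'rV['F_2]_n) :
  is_linear_code C -> (forall i, F i \in C) -> \sum_i a i *: F i \in C.
Proof.
move=> linC CF; elim/big_ind: _ => [|x y|i _]; [exact: code0 | exact: codeD | ].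
by case: (F2P (a i)) => ->; rewrite ?scale0r ?scale1r // code0.
Qed.

(** Duality of subspaces: [p] lies in the sum of [C] and the vectors supported off [S] once it is
    orthogonal to everything orthogonal to both, that is, to the dual words supported in [S]. *)
Lemma realize n (C : {set 'rV['F_2]_n}) (S : {set 'I_n}) (p : 'rV['F_2]_n) :
  is_linear_code C ->
  (forall y, y \in dual_code C -> supp y \subset S -> dotp y p = 0) ->
  exists2 x, x \in C & {in S, forall i, x 0 i = p 0 i}.
Proof.
move=> linC orth.
pose A : 'M['F_2]_(#|C|, n) := \matrix_(k < #|C|) (enum_val k).
pose E : 'M['F_2]_n := diag_mx (indic (~: S)).
have : (p <= col_mx A E)%MS.
  rewrite submxE; apply/eqP/rowP => j; rewrite [RHS]mxE.
  (* The columns of the cokernel are such dual words: they annihilate the rows of [A], which are the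
     codewords, and the rows of [E], which span the vectors off [S]. *)
  set K := cokermx _; pose v : 'rV['F_2]_n := (col j K)^T.
  have vE u : (u *m K) 0 j = dotp v u.
    rewrite dotpC dotpE mxE; apply: eq_bigr => i _; congr (_ * _).
    by rewrite !mxE.
  have [AK EK] : A *m K = 0 /\ E *m K = 0.
    have := mulmx_coker (col_mx A E); rewrite -/K mul_col_mx => /eqP.
    by rewrite col_mx_eq0 => /andP[/eqP-> /eqP->].
  rewrite vE; apply: orth.
    apply/dualP => c Cc; rewrite -vE.
    have -> : c = row (enum_rank_in Cc c) A by rewrite rowK enum_rankK_in.
    by rewrite -row_mul AK mxE mxE.
  apply/subsetP => i; apply: contraLR => iS; rewrite in_supp negbK.
  have := congr1 (fun M : 'M_n => M i j) EK.
  rewrite mul_diag_mx !mxE inE iS mul1r => Kij.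
  by rewrite Kij.
case/submxP => D; rewrite -[D]hsubmxK mul_row_col => ->.
exists (lsubmx D *m A).
  by rewrite mulmx_sum_row; apply: code_sum => // k; rewrite rowK enum_valP.
move=> i iS; rewrite [RHS]mxE [X in _ + X](_ : _ = 0) ?addr0 //.
by rewrite mul_mx_diag !mxE inE iS mulr0.
Qed.

Definition biplane (I J : finType) (A : {set I}) (B : {set J}) (N : I -> J -> bool) : Prop :=
  [/\ #|A| = 11%N, #|B| = 11%N,
      {in A, forall l, #|[set r in B | N l r]| = 5} /\
      {in A &, forall l l', l != l' -> #|[set r in B | N l r && N l' r]| = 2},
      {in B, forall r, #|[set l in A | N l r]| = 5} &
      {in B &, forall r r', r != r' -> #|[set l in A | N l r && N l r']| = 2}]%N.

Lemma complementary_weights (a b : nat) : (a + b.*2 = b + 12 -> 7 < a -> 7 < b -> False)%N.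
Proof. by lia. Qed.

(** Two 6-sets with symmetric difference of size 6 meet in 3 points and cover 9 of the 12; setting
    [r0] aside leaves 2. *)
Lemma disjoint_block_count (i a b u d e : nat) :
  (a + b = 6 -> i + a = 6 -> i + b = 6 -> u = 6 + 6 - i -> d = 12 - u -> d = 1 + e -> e = 2)%N.
Proof. by lia. Qed.

Section GolayStructure.
Variables (n : nat) (C : {set 'rV['F_2]_n}).
Hypothesis n24 : n = 24%N.
Hypotheses (linC : is_linear_code C) (C1 : const_mx 1 \in C).
Hypothesis dC : forall x, x \in dual_code C -> x != 0 -> (7 < wt x)%N.
Hypothesis weightsC : forall c, c \in C -> wt c \in [:: 0; 8; 12; 16; 24]%N.
Implicit Types (l r : 'I_n) (x c w : 'rV['F_2]_n).

(** All weights are divisible by 4, so [wtD] makes the intersection even. *)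
Lemma self_orthogonal c w : c \in C -> w \in C -> odd #|supp c :&: supp w| = false.
Proof.
move=> Cc Cw; have wt4 z : z \in C -> (4 %| wt z)%N.
  by move/weightsC; move: (wt z) => m; rewrite !inE; lia.
have := wt4 _ Cc; have := wt4 _ Cw; have := wt4 _ (codeD linC Cc Cw); have := wtD c w.
by move: (wt _) (wt c) (wt w) #|_| => a b e i; lia.
Qed.

Section Dodecad.
Variable x : 'rV['F_2]_n.
Hypotheses (Cx : x \in C) (wtx : wt x = 12%N).

Lemma card_compl_dodecad : #|~: supp x| = 12%N.
Proof. by rewrite cardsCs setCK card_ord -wtE wtx n24. Qed.

(** Both [y] and [y + x] are dual words and their weights add up to 12, so they cannot both reach
    8. *)
Lemma dual_in_dodecad y : y \in dual_code C -> supp y \subset supp x -> y = 0 \/ y = x.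
Proof.
move=> Dy yx; have [-> | nz_y] := eqVneq y 0; [by left | right].
have Dx : x \in dual_code C.
  by apply/dualP => c Cc; apply/eqP; rewrite dotp_eq0 self_orthogonal.
have Dyx : y + x \in dual_code C.
  by apply/dualP => c Cc; rewrite dotpDl (dualP _ _ Dy) // (dualP _ _ Dx) // addr0.
have [E | nz_yx] := eqVneq (y + x) 0.
  by rewrite -[y]addr0 -(F2_addvv x) addrA E add0r.
have := dC Dy nz_y; have := dC Dyx nz_yx; have := wtD y x.
rewrite (setIidPl yx) -(wtE y) wtx => e h1 h2.
by case: (complementary_weights e h1 h2).
Qed.

Lemma dodecad_pair l0 l : l0 \in supp x -> l \in supp x -> l != l0 ->
  exists2 c, c \in C & supp c :&: supp x = [set l; l0].
Proof.
move=> xl0 xl ne_l; have [| c Cc cE] := @realize _ _ (supp x) (indic [set l; l0]) linC.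
  move=> y Dy yx; have [-> | ->] := dual_in_dodecad Dy yx; first by rewrite dotpC dotp0.
  apply/eqP; rewrite dotp_eq0 supp_indic (setIidPr _) ?cards2 ?ne_l //.
  by apply/subsetP => i; rewrite !in_set2 => /orP[] /eqP->.
exists c => //; apply/setP => i; rewrite in_setI.
have [xi | xi] := boolP (i \in supp x).
  by rewrite andbT in_supp cE // mxE; case: (i \in _).
by rewrite andbF in_set2; apply/esym/norP; split; apply: contraNneq xi => ->.
Qed.

(** Adding [x] raises the weight by 8, and [c] has weight between 2 and 14; among the admissible
    weights only 8 fits. *)
Lemma card_outside_dodecad c : c \in C -> #|supp c :&: supp x| = 2%N -> #|supp c :\: supp x| = 6%N.
Proof.
move=> Cc c2; have := cardsID (supp x) (supp c); rewrite c2 -wtE => wtc.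
have wtcx := wtD c x; rewrite c2 wtx in wtcx.
have := subset_leq_card (_ : supp c :\: supp x \subset ~: supp x).
rewrite card_compl_dodecad setDE subsetIr -setDE => /(_ isT).
have := weightsC Cc; have := weightsC (codeD linC Cc Cx).
by rewrite !inE; lia.
Qed.

Lemma dodecad_words l0 r0 : l0 \in supp x -> r0 \notin supp x -> exists g : 'I_n -> 'rV['F_2]_n,
  forall l, l \in supp x :\ l0 -> [/\ g l \in C, supp (g l) :&: supp x = [set l;
    l0] & r0 \notin supp (g l)].
Proof.
move=> xl0 xr0.
pose P l c := [&& c \in C, supp c :&: supp x == [set l; l0] & r0 \notin supp c].
exists (fun l => odflt 0 [pick c | P l c]) => l; rewrite in_setD1 => /andP[ne_l xl].
case: pickP => [c /and3P[Cc /eqP cx r0c] // | noP].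
have [c Cc cx] := dodecad_pair xl0 xl ne_l.
have [r0c | r0c] := boolP (r0 \in supp c); last by have := noP c; rewrite /P Cc cx eqxx r0c.
(* Adding the complement of the dodecad keeps the trace on the dodecad and removes [r0]. *)
have := noP (c + (const_mx 1 + x)); rewrite /P !codeD // => /negP[].
have -> : supp (c + (const_mx 1 + x)) :&: supp x = supp c :&: supp x.
  apply/setP => i; rewrite !in_setI !in_supp mxE F2_addr_neq0 mxE F2_addr_neq0 mxE /=.
  by case: (x 0 i != 0); case: (c 0 i != 0).
rewrite cx eqxx in_supp mxE F2_addr_neq0 mxE F2_addr_neq0 mxE /=.
by move: xr0 r0c; rewrite !in_supp => -> ->.
Qed.

Section Blocks.
Variables (l0 r0 : 'I_n) (g : 'I_n -> 'rV['F_2]_n).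
Hypothesis xr0 : r0 \notin supp x.
Hypothesis gP : forall l, l \in supp x :\ l0 ->
  [/\ g l \in C, supp (g l) :&: supp x = [set l; l0] & r0 \notin supp (g l)].

Lemma card_block l : l \in supp x :\ l0 -> #|[set r in ~: supp x :\ r0 | r \notin supp (g l)]| =
  5%N.
Proof.
move=> lA; have [Cg gx r0g] := gP lA; have ne_l : l != l0 by case/setD1P: lA.
have := card_outside_dodecad Cg; rewrite gx cards2 ne_l => /(_ erefl) g6.
have -> : [set r in ~: supp x :\ r0 | r \notin supp (g l)] =
  ((~: supp x) :\: (supp (g l) :\: supp x)) :\ r0.
  apply/setP => r; rewrite !inE; case: (r == r0); case: (_ != 0) => //=; case: (_ != 0) => //.
have := cardsD1 r0 (~: supp x :\: (supp (g l) :\: supp x)).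
rewrite in_setD in_setD in_setC xr0 (negbTE r0g) /= => E.
have := cardsD (~: supp x) (supp (g l) :\: supp x).
rewrite (setIidPr _) ?g6 ?card_compl_dodecad; last by rewrite setDE subsetIr.
by rewrite E => -[].
Qed.

(** In [g l + g l'] the coordinate [l0] cancels, so this word again meets the dodecad in two points
    and has six outside. *)
Lemma card_block2 l l' : l \in supp x :\ l0 -> l' \in supp x :\ l0 -> l != l' ->
  #|[set r in ~: supp x :\ r0 | (r \notin supp (g l)) && (r \notin supp (g l'))]| = 2%N.
Proof.
move=> lA lA' ne_ll.
have [Cg gx r0g] := gP lA; have ne_l : l != l0 by case/setD1P: lA.
have [Cg' gx' r0g'] := gP lA'; have ne_l' : l' != l0 by case/setD1P: lA'.
have := card_outside_dodecad Cg; rewrite gx cards2 ne_l => /(_ erefl) g6.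
have := card_outside_dodecad Cg'; rewrite gx' cards2 ne_l' => /(_ erefl) g6'.
have := card_outside_dodecad (codeD linC Cg Cg').
have -> : supp (g l + g l') :&: supp x = [set l; l'].
  have -> : supp (g l + g l') :&: supp x =
    (supp (g l) :&: supp x :\: (supp (g l') :&: supp x)) :|: (supp (g l') :&: supp x :\: (supp (g l) :&: supp x)).
    rewrite suppD; apply/setP => i; rewrite !in_setU !in_setI !in_setD !in_setI !in_setU !in_setD.
    by case: (i \in supp x); case: (i \in supp (g l)); case: (i \in supp (g l')).
  rewrite gx gx'; apply/setP => i; rewrite !inE.
  case: (eqVneq i l) => [-> | _]; first by rewrite (negbTE ne_l) (negbTE ne_ll).
  case: (eqVneq i l') => [-> | _]; first by rewrite (negbTE ne_l').
  by case: (i == l0).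
rewrite cards2 ne_ll => /(_ erefl); rewrite suppD.
move: xr0 r0g r0g' g6 g6' card_compl_dodecad; set G := supp (g l); set G' := supp (g l');
  set X := supp x.
move=> xr0' r0g r0g' g6 g6' cX.
have -> : ((G :\: G') :|: (G' :\: G)) :\: X =
  ((G :\: X) :\: (G' :\: X)) :|: ((G' :\: X) :\: (G :\: X)).
  by apply/setP => i; rewrite !in_setD !in_setU !in_setD; case: (i \in X); case: (i \in G);
    case: (i \in G').
rewrite cardsU [_ :&: _](_ : _ = set0); last first.
  by apply/setP => i; rewrite !in_setI !in_setD in_set0; case: (i \in X); case: (i \in G);
    case: (i \in G').
rewrite cards0 subn0 => sym6.
have e1 := cardsID (G' :\: X) (G :\: X); have e2 := cardsID (G :\: X) (G' :\: X).
have e3 := cardsU (G :\: X) (G' :\: X); rewrite setIC in e2.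
have e4 := cardsD (~: X) ((G :\: X) :|: (G' :\: X)).
rewrite (setIidPr _) in e4; last by rewrite subUset !setDE !subsetIr.
have e5 := cardsD1 r0 (~: X :\: ((G :\: X) :|: (G' :\: X))).
rewrite in_setD in_setU !in_setD in_setC (negbTE r0g) (negbTE r0g') (negbTE xr0') /= in e5.
have -> : [set r in ~: X :\ r0 | (r \notin G) && (r \notin G')] =
  (~: X :\: ((G :\: X) :|: (G' :\: X))) :\ r0.
  apply/setP => r; rewrite in_set !in_setD1 !in_setD in_setU !in_setD in_setC.
  by case: (r == r0); case: (r \in X); case: (r \in G); case: (r \in G').
rewrite g6 in e1; rewrite g6' in e2; rewrite g6 g6' in e3; rewrite cX in e4.
exact: disjoint_block_count sym6 e1 e2 e3 e4 e5.
Qed.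
End Blocks.
End Dodecad.

Lemma golay_biplane x : x \in C -> wt x = 12%N -> exists l0 r0 (g : 'I_n -> 'rV['F_2]_n),
  [/\ l0 \in supp x, r0 \notin supp x,
      forall l, l \in supp x :\ l0 -> [/\ g l \in C, supp (g l) :&: supp x = [set l;
        l0] & r0 \notin supp (g l)] &
      biplane (supp x :\ l0) (~: supp x :\ r0) (fun l r => r \notin supp (g l))].
Proof.
move=> Cx wtx.
have [l0 xl0] : exists l0, l0 \in supp x by apply/set0Pn; rewrite -card_gt0 -wtE wtx.
have [r0] : exists r0, r0 \in ~: supp x by apply/set0Pn; rewrite -card_gt0 card_compl_dodecad.
rewrite in_setC => xr0; have [g gP] := dodecad_words Cx wtx xl0 xr0.
pose x' := const_mx 1 + x; have Cx' : x' \in C by apply: codeD.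
have wtx' : wt x' = 12%N by rewrite wt_compl wtx n24.
have suppx' : supp x' = ~: supp x.
  by apply/setP => i; rewrite in_setC !in_supp mxE F2_addr_neq0 mxE.
have xl0' : l0 \notin supp x' by rewrite suppx' in_setC xl0.
have xr0' : r0 \in supp x' by rewrite suppx' in_setC.
have [h hP] := dodecad_words Cx' wtx' xr0' xl0'.
(* The conditions on points follow from those on blocks in the complementary dodecad: [g l] and
   [h r] can meet only in [l] and [r], and evenness of the intersection makes both memberships
   equivalent. *)
have dual_inc l r : l \in supp x :\ l0 -> r \in supp x' :\ r0 -> (r \notin supp (g l)) =
  (l \notin supp (h r)).
  move=> lA rB; have [Cg gx r0g] := gP l lA; have [Ch hx l0h] := hP r rB.
  have := self_orthogonal Cg Ch; rewrite -(cardsID (supp x)).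
  have -> : supp (g l) :&: supp (h r) :&: supp x = if l \in supp (h r) then [set l] else set0.
    rewrite setIAC gx; apply/setP => i; rewrite in_setI in_set2.
    case: (eqVneq i l) => [-> | ne_i] /=; first by case: ifP; rewrite ?in_set1 ?eqxx ?in_set0.
    case: (eqVneq i l0) => [-> | _] /=; last by case: ifP; rewrite ?in_set1 ?(negbTE ne_i) ?in_set0.
    rewrite (negbTE l0h); case: ifP; rewrite ?in_set1 ?in_set0 //.
    by case/setD1P: lA => /negbTE ne _ _; rewrite eq_sym ne.
  have -> : (supp (g l) :&: supp (h r)) :\: supp x = if r \in supp (g l) then [set r] else set0.
    rewrite setDE -suppx' -setIA hx; apply/setP => i; rewrite in_setI in_set2.
    case: (eqVneq i r) => [-> | ne_i] /=; first by rewrite andbT; case: ifP;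
      rewrite ?in_set1 ?eqxx ?in_set0.
    case: (eqVneq i r0) => [-> | _] /=; last by rewrite andbF; case: ifP;
      rewrite ?in_set1 ?(negbTE ne_i) ?in_set0.
    rewrite (negbTE r0g) /=; case: ifP; rewrite ?in_set1 ?in_set0 //.
    by case/setD1P: rB => /negbTE ne _ _; rewrite eq_sym ne.
  by case: (l \in _); case: (r \in _); rewrite ?cards1 ?cards0.
exists l0, r0, g; split=> //; rewrite -suppx'.
have suppx : ~: supp x' = supp x by rewrite suppx' setCK.
split.
- by have := cardsD1 l0 (supp x); rewrite xl0 -(wtE x) wtx add1n => -[<-].
- by have := cardsD1 r0 (supp x'); rewrite xr0' -(wtE x') wtx' add1n => -[<-].
- split=> [l lA | l l' lA lA' ne]; rewrite suppx'.
    exact: (card_block Cx wtx xr0 gP).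
  exact: (card_block2 Cx wtx xr0 gP).
- move=> r rB; rewrite -(card_block Cx' wtx' xl0' hP rB) suppx.
  by apply: eq_card => l; rewrite [LHS]in_set [RHS]in_set; apply: andb_id2l => lA;
    rewrite dual_inc // in_setD1 -andbC.
- move=> r r' rB rB' ne; rewrite -(card_block2 Cx' wtx' xl0' hP rB rB' ne) suppx.
  by apply: eq_card => l; rewrite [LHS]in_set [RHS]in_set; apply: andb_id2l => lA;
    rewrite !dual_inc // in_setD1 -andbC.
Qed.
End GolayStructure.

(** * Uniqueness of the biplane of order 3 *)

(** A block other than the chosen one meets it in two of its five points, hence is labelled by an
    edge of the complete graph on them. *)
Definition edges5 : seq (nat * nat) :=
  [:: (0, 1); (0, 2); (0, 3); (0, 4); (1, 2); (1, 3); (1, 4); (2, 3); (2, 4); (3, 4)]%N.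

Definition incident (k : nat) (p : nat * nat) : bool := (k == p.1) || (k == p.2).

(* The twelve 5-cycles of the complete graph on five vertices, as bit vectors over [edges5]; two
   distinct cycles share exactly two edges if and only if they belong to the same family. *)
Definition pentagons (b : bool) : seq (seq bool) := map (map (fun m => m == 1%N))
  (if b then
    [:: [:: 0; 0; 1; 1; 1; 0; 1; 1; 0; 0]; [:: 0; 1; 0; 1; 1; 1; 0; 0; 0; 1];
        [:: 0; 1; 1; 0; 0; 1; 1; 0; 1; 0]; [:: 1; 0; 0; 1; 0; 1; 0; 1; 1; 0];
        [:: 1; 0; 1; 0; 1; 0; 0; 0; 1; 1]; [:: 1; 1; 0; 0; 0; 0; 1; 1; 0; 1]]
  else
    [:: [:: 0; 0; 1; 1; 1; 1; 0; 0; 1; 0]; [:: 0; 1; 0; 1; 0; 1; 1; 1; 0; 0];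
        [:: 0; 1; 1; 0; 1; 0; 1; 0; 0; 1]; [:: 1; 0; 0; 1; 1; 0; 0; 1; 0; 1];
        [:: 1; 0; 1; 0; 0; 0; 1; 1; 1; 0]; [:: 1; 1; 0; 0; 0; 1; 0; 0; 1; 1]])%N.

Definition star_column (k : nat) : seq bool := true :: map (incident k) edges5.

(** Incidence vectors of the five points on the chosen block, followed by those of the six points
    off it; the first entry refers to the chosen block. *)
Definition biplane_columns (b : bool) : seq (seq bool) :=
  map star_column (iota 0 5) ++ map (cons false) (pentagons b).

Definition meet (u v : seq bool) : nat := count (fun p => p.1 && p.2) (zip u v).

Lemma meet_map (I : Type) (f g : I -> bool) (s : seq I) :
  meet (map f s) (map g s) = count (fun i => f i && g i) s.
Proof. by rewrite /meet; elim: s => //= i s ->. Qed.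

Fixpoint bit_vectors (m : nat) : seq (seq bool) :=
  if m is m'.+1 then map (cons true) (bit_vectors m') ++ map (cons false) (bit_vectors m')
  else [:: [::]].

Lemma mem_bit_vectors (v : seq bool) : v \in bit_vectors (size v).
Proof.
by elim: v => //= a v IHv; rewrite mem_cat; case: a; rewrite map_f ?orbT.
Qed.

(** The hypothesis says that each of the five vertices has degree 2 in the edge set [v], which
    forces a 5-cycle; all $2^{10}$ edge sets are tested. *)
Lemma two_regular_pentagon (v : seq bool) :
  size v = 10%N -> all (fun k => meet (false :: v) (star_column k) == 2%N) (iota 0 5) ->
  v \in pentagons true ++ pentagons false.
Proof.
have chk : all (fun w => all (fun k =>
  meet (false :: w) (star_column k) == 2%N) (iota 0 5) ==> (w \in pentagons true ++ pentagons false)) (bit_vectors 10).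
  by vm_compute.
by move=> size_v; apply/implyP; apply: (allP chk); rewrite -size_v mem_bit_vectors.
Qed.

Lemma pentagons_family (b : bool) (u v : seq bool) :
  u \in pentagons b -> v \in pentagons true ++ pentagons false ->
  meet u v = 2%N -> v \in pentagons b /\ u != v.
Proof.
have chk : all (fun b => all (fun u => all (fun v =>
  (meet u v == 2%N) ==> (v \in pentagons b) && (u != v))
    (pentagons true ++ pentagons false)) (pentagons b)) [:: true; false].
  by vm_compute.
move=> ub vF uv; apply/andP.
have := allP (allP (allP chk b _) u ub) v vF; rewrite uv eqxx; apply.
by case: (b).
Qed.

Lemma card_set_count (I : finType) (A : {set I}) (s : seq I) (P : pred I) :
  uniq s -> s =i A -> #|[set l in A | P l]| = count P s.
Proof.
move=> uniq_s sA; rewrite -size_filter -(card_uniqP _) ?filter_uniq //.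
by apply: eq_card => l; rewrite inE mem_filter sA andbC.
Qed.

Section Biplane.
Variables (I J : finType) (A : {set I}) (B : {set J}) (N : I -> J -> bool).
Hypothesis plane : biplane A B N.

Lemma biplane_unique : exists (b : bool) (s1 : seq I) (s2 : seq J),
  [/\ uniq s1, s1 =i A, uniq s2, s2 =i B &
      [seq [seq N l r | l <- s1] | r <- s2] = biplane_columns b].
Proof.
have [cA cB [row5 row2] col5 col2] := plane.
have [l1 l1A] : exists l, l \in A by apply/set0Pn; rewrite -card_gt0 cA.
pose bs := enum [set r in B | N l1 r].
have size_bs : size bs = 5%N by rewrite -cardE row5.
have uniq_bs : uniq bs := enum_uniq _.
have mem_bs r : (r \in bs) = (r \in B) && N l1 r by rewrite mem_enum inE.
have [j0 _] : exists r, r \in B by apply/set0Pn; rewrite -card_gt0 cB.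
pose p_ k := nth j0 bs k.
have p_bs k : (k < 5)%N -> p_ k \in bs by move=> ltk; rewrite mem_nth ?size_bs.
have pB k : (k < 5)%N -> p_ k \in B by move/p_bs; rewrite mem_bs => /andP[].
have pN k : (k < 5)%N -> N l1 (p_ k) by move/p_bs; rewrite mem_bs => /andP[].
have p_inj i j : (i < 5)%N -> (j < 5)%N -> (p_ i == p_ j) = (i == j).
  by move=> lti ltj; rewrite nth_uniq ?size_bs.
have edgeP e : e \in edges5 -> [/\ (e.1 < 5)%N, (e.2 < 5)%N & e.1 != e.2].
  by move=> eE; apply/and3P; move: e eE; apply/allP; vm_compute.
(* Two points of [l1] lie on exactly two blocks; [lam] selects the one other than [l1]. The default
   [l1] is excluded by [lamP]. *)
pose lam e := odflt l1 [pick l in A | [&& l != l1, N l (p_ e.1) & N l (p_ e.2)]].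
have lamP e : e \in edges5 -> [/\ lam e \in A, lam e != l1,
  N (lam e) (p_ e.1) & N (lam e) (p_ e.2)].
  move=> /edgeP[lt1 lt2 ne12]; rewrite /lam; case: pickP => [l /and4P[] | no_l] //=.
  have : (1 < #|[set l in A | N l (p_ e.1) && N l (p_ e.2)]|)%N.
    by rewrite col2 ?pB ?p_inj.
  case/card_gt1P => x [y [xS yS ne_xy]].
  have [x1 | x1] := eqVneq x l1.
    by have := no_l y; move: yS; rewrite !inE => /and3P[-> -> ->]; rewrite -x1 eq_sym ne_xy.
  by have := no_l x; move: xS; rewrite !inE => /and3P[-> -> ->]; rewrite x1.
have lamN e k : e \in edges5 -> (k < 5)%N -> N (lam e) (p_ k) = incident k e.
  move=> eE ltk; have [lt1 lt2 ne12] := edgeP e eE; have [lA ne_l N1 N2] := lamP e eE.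
  have eqS : [set p_ e.1; p_ e.2] = [set r in B | N l1 r && N (lam e) r].
    apply/eqP; rewrite eqEcard row2 // 1?eq_sym // cards2 p_inj // ne12 andbT.
    by apply/subsetP => r; rewrite !inE => /orP[] /eqP->; rewrite pB ?pN ?N1 ?N2.
  have := congr1 (fun S : {set J} => p_ k \in S) eqS.
  by rewrite !inE pB ?pN ?p_inj //= => <-.
pose s1 := l1 :: map lam edges5.
(* The incidences with the five points of [l1] already separate the eleven blocks. *)
have uniq_s1 : uniq s1.
  apply: (@map_uniq _ _ (fun l => [seq N l (p_ k) | k <- iota 0 5])).
  have -> : [seq [seq N l (p_ k) | k <- iota 0 5] | l <- s1] =
      nseq 5 true :: [seq [seq incident k e | k <- iota 0 5] | e <- edges5].
    rewrite /s1 map_cons -map_comp; congr cons; first by rewrite /= !pN.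
    apply/eq_in_map => e eE; apply/eq_in_map => k; rewrite mem_iota => /andP[_ ltk].
    exact: lamN.
  by vm_compute.
have s1A : s1 =i A.
  have sub : {subset s1 <= enum A}.
    move=> l; rewrite inE mem_enum => /orP[/eqP-> // | /mapP[e eE ->]].
    by case: (lamP e eE).
  have [_ eqs] := uniq_min_size uniq_s1 sub (eq_leq (etrans (esym (cardE A)) cA)).
  by move=> l; rewrite eqs mem_enum.
pose col r := [seq N l r | l <- s1].
have meet_col r r' : r \in B -> r' \in B -> r != r' -> meet (col r) (col r') = 2%N.
  by move=> rB r'B ne; rewrite meet_map -(card_set_count _ uniq_s1 s1A) col2.
have col_p k : (k < 5)%N -> col (p_ k) = star_column k.
  move=> ltk; rewrite /col /s1 map_cons pN // /star_column -map_comp; congr cons.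
  by apply/eq_in_map => e eE; rewrite /= lamN.
pose rs := enum [set r in B | ~~ N l1 r].
have mem_rs r : (r \in rs) = (r \in B) && ~~ N l1 r by rewrite mem_enum inE.
have size_rs : size rs = 6%N.
  rewrite -cardE; have := cardsID [set r | N l1 r] B; rewrite cB.
  have -> : B :&: [set r | N l1 r] = [set r in B | N l1 r] by apply/setP => r; rewrite !inE.
  have -> : B :\: [set r | N l1 r] = [set r in B | ~~ N l1 r] by apply/setP => r;
    rewrite !inE andbC.
  by rewrite row5 // => -[].
pose v_ r := behead (col r).
have col_v r : r \in rs -> col r = false :: v_ r.
  by rewrite mem_rs => /andP[_ /negbTE nN]; rewrite /v_ /col /= nN.
have v_pent r : r \in rs -> v_ r \in pentagons true ++ pentagons false.
  move=> rR; have := rR; rewrite mem_rs => /andP[rB nN].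
  apply: two_regular_pentagon; first by rewrite size_behead /col size_map.
  apply/allP => k; rewrite mem_iota => /andP[_ ltk].
  rewrite -col_v // -col_p // meet_col ?pB //.
  by apply: contraNneq nN => ->; rewrite pN.
have v_meet r r' : r \in rs -> r' \in rs -> r != r' -> meet (v_ r) (v_ r') = 2%N.
  move=> rR r'R ne; have := rR; have := r'R; rewrite !mem_rs => /andP[r'B _] /andP[rB _].
  by rewrite -(meet_col r r') // !col_v.
have [r1 r1R] : exists r, r \in rs by case: (rs) size_rs => // r rs' _; exists r; rewrite mem_head.
have [b r1b] : exists b, v_ r1 \in pentagons b.
  by have := v_pent r1 r1R; rewrite mem_cat => /orP[]; [exists true | exists false].
have all_b r : r \in rs -> v_ r \in pentagons b.
  move=> rR; have [-> // | ne] := eqVneq r r1.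
  by have [] := pentagons_family r1b (v_pent r rR) (v_meet r1 r r1R rR ltac:(by rewrite eq_sym)).
have uniq_vs : uniq (map v_ rs).
  rewrite map_inj_in_uniq ?enum_uniq // => r r' rR r'R eqv.
  apply/eqP/negPn/negP => ne.
  have [_] := pentagons_family (all_b r rR) (v_pent r' r'R) (v_meet r r' rR r'R ne).
  by rewrite eqv eqxx.
have sub_vs : {subset map v_ rs <= pentagons b} by move=> v /mapP[r rR ->]; exact: all_b.
(* The six points off [l1] give six distinct cycles of one family, hence the whole family. *)
have [_ vs_pent] : (size (map v_ rs) = size (pentagons b)) * (map v_ rs =i pentagons b).
  by apply: uniq_min_size => //; rewrite !size_map size_rs; case: (b).
pose r_ v := nth j0 rs (index v (map v_ rs)).
have r_P v : v \in pentagons b -> r_ v \in rs /\ v_ (r_ v) = v.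
  rewrite -vs_pent => vV; have lt : (index v (map v_ rs) < size rs)%N by rewrite -(size_map v_) index_mem.
  by split; [rewrite mem_nth | rewrite /r_ -(nth_map j0 (v_ j0)) // nth_index].
pose s2 := map p_ (iota 0 5) ++ map r_ (pentagons b).
have cols_s2 : [seq [seq N l r | l <- s1] | r <- s2] = biplane_columns b.
  rewrite map_cat; congr (_ ++ _); rewrite -map_comp.
    by apply/eq_in_map => k; rewrite mem_iota => /andP[_ ltk]; exact: col_p.
  by apply/eq_in_map => v /r_P[rR vE]; rewrite -[LHS]/(col (r_ v)) col_v // vE.
have uniq_s2 : uniq s2.
  by apply: (@map_uniq _ _ col); rewrite cols_s2; case: (b); vm_compute.
have sub2 : {subset s2 <= enum B}.
  move=> r; rewrite mem_cat mem_enum => /orP[] /mapP[].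
    by move=> k; rewrite mem_iota => /andP[_ ltk] ->; exact: pB.
  by move=> v /r_P[rR _] ->; move: rR; rewrite mem_rs => /andP[].
have [_ s2B] : (size s2 = size (enum B)) * (s2 =i enum B).
  by apply: uniq_min_size => //; rewrite -cardE cB size_cat !size_map; case: (b).
exists b, s1, s2; split=> // r.
by rewrite s2B mem_enum.
Qed.
End Biplane.

(** * Identification with the Golay code *)

Definition golay_bit (i j : nat) : bool :=
  (j == 23)%N || ((i <= j <= i + 11)%N && (nth 0%N golay_g (j - i) == 1%N)).

Lemma golay_genE i j : golay_gen i j = (golay_bit i j)%:R.
Proof.
rewrite mxE /golay_bit; case: ifP => //= _; case: ifP => //= _.
have : (nth 0%N golay_g (j - i) <= 1)%N.
  have [lt | ge] := ltnP (j - i) (size golay_g); last by rewrite nth_default.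
  by have /allP := (isT : all (fun m => m <= 1)%N golay_g); apply; exact: mem_nth.
by case: (nth _ _ _) => [|[|]].
Qed.

(** The first twelve columns of [golay_gen] are triangular with unit diagonal, so encoding is
    injective. *)
Lemma card_G24 : #|G24| = (2 ^ 12)%N.
Proof.
rewrite card_imset ?card_mx ?card_Fp //.
pose A : 'M['F_2]_12 := lsubmx (golay_gen : 'M_(12, 12 + 12)).
have AE i j : A i j = (golay_bit i j)%:R.
  by rewrite mxE golay_genE.
have unitA : A \in unitmx.
  rewrite unitmxE -det_tr det_trig.
    rewrite big1 ?unitr1 // => i _; rewrite mxE AE /golay_bit subnn leqnn leq_addr /= orbT.
    by [].
  apply/is_trig_mxP => i j lt_ij; rewrite mxE AE /golay_bit [(j <= i)%N]leqNgt lt_ij /= orbF.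
  by case: eqP => // i23; have := ltn_ord i; rewrite i23.
move=> m m' eqm; rewrite -[m](mulmxK unitA) -[m'](mulmxK unitA); congr (_ *m _).
by rewrite /A !mulmx_lsub; congr lsubmx.
Qed.


(* Position, in the labelling of a code by a dodecad and its biplane, of each coordinate of [G24],
   and the expression of the rows of [golay_gen] in the corresponding generators. *)
Definition golay_position (b : bool) : seq nat := (if b then
    [:: 0; 12; 1; 5; 4; 23; 11; 2; 7; 8; 3; 10; 13; 6; 9; 18; 20; 14; 22; 15; 16; 21; 17; 19]
  else
    [:: 0; 12; 1; 8; 7; 21; 11; 2; 4; 5; 6; 10; 14; 3; 9; 19; 18; 13; 23; 15; 16; 22; 17; 20])%N.

Definition golay_combination (b : bool) : seq (seq nat) := (if b then
    [:: [:: 0; 1; 0; 1; 0; 0; 1; 1; 1; 1; 1; 0; 0];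
        [:: 1; 0; 1; 0; 1; 1; 0; 1; 1; 1; 1; 0; 0];
        [:: 0; 1; 0; 0; 1; 0; 1; 0; 0; 1; 1; 1; 0];
        [:: 0; 0; 0; 1; 0; 0; 1; 1; 1; 1; 1; 0; 0];
        [:: 0; 1; 1; 1; 0; 0; 1; 1; 0; 0; 0; 1; 0];
        [:: 0; 0; 0; 1; 1; 0; 0; 0; 0; 1; 0; 1; 0];
        [:: 0; 1; 1; 1; 0; 1; 1; 1; 0; 1; 1; 0; 0];
        [:: 0; 0; 0; 1; 0; 0; 0; 1; 0; 1; 0; 1; 0];
        [:: 0; 0; 0; 0; 1; 0; 0; 1; 1; 0; 1; 0; 0];
        [:: 0; 0; 0; 0; 0; 0; 0; 1; 0; 1; 1; 1; 0];
        [:: 0; 0; 0; 0; 1; 0; 0; 0; 0; 0; 1; 0; 0];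
        [:: 0; 0; 0; 0; 0; 0; 0; 1; 0; 0; 0; 1; 0]]
  else
    [:: [:: 0; 1; 0; 1; 1; 1; 1; 0; 0; 1; 1; 0; 0];
        [:: 1; 0; 1; 0; 1; 1; 1; 1; 1; 0; 1; 0; 0];
        [:: 0; 1; 0; 0; 0; 0; 1; 1; 0; 1; 1; 1; 0];
        [:: 0; 0; 0; 1; 1; 1; 1; 0; 0; 1; 1; 0; 0];
        [:: 0; 1; 1; 1; 1; 0; 0; 0; 0; 1; 0; 1; 0];
        [:: 0; 0; 0; 1; 0; 0; 1; 1; 0; 0; 0; 1; 0];
        [:: 0; 1; 1; 1; 1; 0; 1; 0; 1; 1; 1; 0; 0];
        [:: 0; 0; 0; 1; 1; 0; 1; 0; 0; 0; 0; 1; 0];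
        [:: 0; 0; 0; 0; 1; 1; 0; 1; 0; 0; 1; 0; 0];
        [:: 0; 0; 0; 0; 1; 0; 1; 0; 0; 0; 1; 1; 0];
        [:: 0; 0; 0; 0; 0; 0; 0; 1; 0; 0; 1; 0; 0];
        [:: 0; 0; 0; 0; 1; 0; 0; 0; 0; 0; 0; 1; 0]])%N.

(** Bits of a word [g l] in the order [l0], rest of the dodecad, [r0], rest of the complement. The
    last part is negated since incidence in the biplane means absence from the word. *)
Definition block_bits (b : bool) (k : nat) : seq bool :=
  true :: [seq j == k | j <- iota 0 11] ++ false :: [seq ~~ nth false c k | c <- biplane_columns b].

Definition dodecad_generators (b : bool) : seq (seq bool) :=
  [:: nseq 24 true, nseq 12 true ++ nseq 12 false & [seq block_bits b k | k <- iota 0 11]].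

Definition xorv (u v : seq bool) : seq bool := [seq p.1 (+) p.2 | p <- zip u v].

Definition golay_row_bits (b : bool) (i : nat) : seq bool :=
  foldr xorv (nseq 24 false)
    (mask (map (fun m => m == 1%N) (nth [::] (golay_combination b) i)) (dodecad_generators b)).

Lemma golay_row_bitsE b i j : (i < 12)%N -> (j < 24)%N ->
  nth false (golay_row_bits b i) (nth 0%N (golay_position b) j) = golay_bit i j.
Proof.
have chk : all (fun b => all (fun i => all (fun j =>
    nth false (golay_row_bits b i) (nth 0%N (golay_position b) j) == golay_bit i j)
    (iota 0 24)) (iota 0 12)) [:: true; false].
  by vm_compute.
move=> lti ltj; apply/eqP.
have bM : b \in [:: true; false] by case: (b).
by apply: (allP (allP (allP chk b bM) i _) j _); rewrite mem_iota.
Qed.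

Section Labelling.
Variables (n : nat) (C : {set 'rV['F_2]_n}) (s : seq 'I_n).
Hypotheses (linC : is_linear_code C) (size_s : size s = 24%N) (s_all : forall i, i \in s).

Definition labelled (w : seq bool) : 'rV['F_2]_n := \row_i (nth false w (index i s))%:R.

Lemma labelled_bits c : labelled [seq i \in supp c | i <- s] = c.
Proof.
apply/rowP => i; rewrite mxE (nth_map i) ?index_mem // nth_index // in_supp.
by rewrite -F2_neq0.
Qed.

Lemma labelled_xorv u v : size u = 24%N -> size v = 24%N ->
  labelled (xorv u v) = labelled u + labelled v.
Proof.
move=> su sv; apply/rowP => i; rewrite !mxE (nth_map (false, false)); last first.
  by rewrite size_zip su sv minnn -size_s index_mem.
rewrite nth_zip ?su ?sv //=.
by case: (nth _ _ _); case: (nth _ _ _); apply: val_inj.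
Qed.

Lemma labelled_span (ws : seq (seq bool)) (m : seq bool) :
  all (fun w => size w == 24%N) ws -> (forall w, w \in ws -> labelled w \in C) ->
  labelled (foldr xorv (nseq 24 false) (mask m ws)) \in C.
Proof.
move=> /allP size_ws Cws.
have CW : forall w, w \in mask m ws -> size w = 24%N /\ labelled w \in C.
  by move=> w /mem_mask wW; split; [apply/eqP/size_ws | apply: Cws].
elim: (mask m ws) CW => [|w us IHus] CW.
  rewrite (_ : labelled _ = 0) ?code0 //.
  by apply/rowP => i; rewrite !mxE -[foldr _ _ _]/(nseq 24 false) nth_nseq if_same.
have size_f : size (foldr xorv (nseq 24 false) us) = 24%N.
  elim: us CW {IHus} => [|u us IHu] CW; first by rewrite size_nseq.
  rewrite /= size_map size_zip IHu ?(CW u _).1 ?minnn ?in_cons ?eqxx ?orbT // => v.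
  by rewrite in_cons => /orP[/eqP-> | vU]; apply: CW; rewrite !in_cons ?eqxx ?vU ?orbT.
have [size_w Cw] := CW w (mem_head _ _).
rewrite -[foldr _ _ _]/(xorv w (foldr xorv (nseq 24 false) us)) labelled_xorv // codeD // IHus // => v vU.
by apply: CW; rewrite in_cons vU orbT.
Qed.
End Labelling.

Section Equivalence.
Variables (n : nat) (C : {set 'rV['F_2]_n}).
Hypotheses (n24 : n = 24%N) (linC : is_linear_code C) (C1 : const_mx 1 \in C).
Hypothesis cardC : #|C| = (2 ^ 12)%N.

(** After relabelling, [C] contains every row of [golay_gen], hence [G24]; both have $2^{12}$
    elements. *)
Lemma equiv_G24_of_generators (b : bool) (s : seq 'I_n) :
  uniq s -> size s = 24%N ->
  (forall w, w \in dodecad_generators b -> labelled s w \in C) -> code_equiv C G24.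
Proof.
move=> uniq_s size_s genC.
have s_all i : i \in s.
  have [_ ->] := uniq_min_size uniq_s (s2 := enum 'I_n) ltac:(by move=> j _; rewrite mem_enum)
    ltac:(by rewrite size_enum_ord size_s n24).
  by rewrite mem_enum.
have lt0n : (0 < n)%N by rewrite n24.
pose i0 := Ordinal lt0n.
have posP (j : 'I_24) : (nth 0%N (golay_position b) j < 24)%N.
  have /allP := (isT : all (fun k => k < 24)%N (golay_position true ++ golay_position false));
    apply.
  by rewrite mem_cat; case: (b); rewrite mem_nth ?orbT.
pose f (j : 'I_24) := nth i0 s (nth 0%N (golay_position b) j).
have f_inj : injective f.
  move=> j j' /eqP; rewrite nth_uniq ?size_s ?posP // nth_uniq; try by case: (b).
  by move/eqP/val_inj.
have f_bij : bijective f by apply: inj_card_bij => //; rewrite !card_ord n24.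
exists f; split=> //.
pose phi (c : 'rV['F_2]_n) : 'rV['F_2]_24 := \row_j c 0 (f j).
have phi_inj : injective phi.
  have [h _ fK] := f_bij; move=> c c' eq_phi; apply/rowP => i.
  by have := congr1 (fun u : 'rV_24 => u 0 (h i)) eq_phi; rewrite !mxE fK.
apply/esym/eqP; rewrite eqEcard card_G24 card_imset // cardC leqnn andbT.
apply/subsetP => _ /imsetP[m _ ->].
pose y (i : 'I_12) := labelled s (golay_row_bits b i).
have Cy i : y i \in C.
  apply: (labelled_span linC size_s s_all) genC.
  by case: (b); vm_compute.
apply/imsetP; exists (\sum_i m 0 i *: y i); first exact: code_sum.
apply/rowP => j; rewrite !mxE summxE; apply: eq_bigr => i _.
rewrite golay_genE !mxE index_uniq ?size_s ?posP // golay_row_bitsE //.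
Qed.

Hypothesis dC : forall x, x \in dual_code C -> x != 0 -> (7 < wt x)%N.
Hypothesis weightsC : forall c, c \in C -> wt c \in [:: 0; 8; 12; 16; 24]%N.

Lemma golay_unique x : x \in C -> wt x = 12%N -> code_equiv C G24.
Proof.
move=> Cx wtx; have [l0 [r0 [g [xl0 xr0 gP plane]]]] := golay_biplane n24 linC C1 dC weightsC Cx wtx.
have [b [s1 [s2 [uniq1 s1A uniq2 s2B cols]]]] := biplane_unique plane.
have [cA cB _ _ _] := plane.
have size1 : size s1 = 11%N by rewrite -(card_uniqP uniq1) (eq_card s1A).
have size2 : size s2 = 11%N by rewrite -(card_uniqP uniq2) (eq_card s2B).
have in1 l : l \in s1 -> l \in supp x by rewrite s1A => /setD1P[].
have in2 r : r \in s2 -> r \notin supp x by rewrite s2B => /setD1P[_]; rewrite in_setC.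
(* This is the coordinate order assumed by [block_bits], with [s1] and [s2] as ordered by
   [biplane_unique]. *)
pose s := l0 :: s1 ++ r0 :: s2.
have uniq_s : uniq s.
  rewrite cons_uniq mem_cat in_cons cat_uniq cons_uniq uniq1 uniq2 /= !negb_or andbT.
  have -> : l0 \notin s1 by rewrite s1A setD11.
  have -> : l0 != r0 by apply: contraTneq xl0 => ->.
  have -> : l0 \notin s2 by apply: contraL xl0 => /in2.
  have -> : r0 \notin s1 by apply: contra xr0 => /in1.
  have -> : r0 \notin s2 by rewrite s2B setD11.
  by rewrite /= andbT; apply/hasPn => r rS /=; apply: contra (in2 r rS) => /in1.
have size_s : size s = 24%N by rewrite /= size_cat /= size1 size2.
have s_all i : i \in s.
  have [_ ->] := uniq_min_size uniq_s (s2 := enum 'I_n) ltac:(by move=> j _; rewrite mem_enum)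
    ltac:(by rewrite size_enum_ord size_s n24).
  by rewrite mem_enum.
have bits c w : c \in C -> [seq i \in supp c | i <- s] = w -> labelled s w \in C.
  by move=> Cc <-; rewrite labelled_bits.
apply: (@equiv_G24_of_generators b s uniq_s size_s) => w; rewrite 2!in_cons =>
  /or3P[/eqP-> | /eqP-> | ].
- apply: (bits _ _ C1); rewrite supp1 -size_s -(size_map (fun i => i \in [set: 'I_n])).
  by apply/all_pred1P/allP => v /mapP[i _ ->]; rewrite /= in_setT.
- apply: (bits _ _ Cx); rewrite /s -cat_cons map_cat; congr (_ ++ _).
    have -> : 12%N = size [seq i \in supp x | i <- l0 :: s1] by rewrite size_map /= size1.
    apply/all_pred1P/allP => v /mapP[i]; rewrite in_cons => iS -> /=.
    by case/orP: iS => [/eqP-> | /in1 ->]; rewrite ?xl0.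
  have -> : 12%N = size [seq i \in supp x | i <- r0 :: s2] by rewrite size_map /= size2.
  apply/all_pred1P/allP => v /mapP[i]; rewrite in_cons => iS -> /=.
  by case/orP: iS => [/eqP-> | /in2/negbTE ->]; rewrite ?(negbTE xr0).
case/mapP => k; rewrite mem_iota add0n => /andP[_ ltk] ->.
pose l := nth l0 s1 k; have lS : l \in s1 by rewrite mem_nth ?size1.
have [Cg gx r0g] := gP l (etrans (esym (s1A l)) lS).
have g_in i : i \in supp x -> (i \in supp (g l)) = (i == l) || (i == l0).
  by move=> xi; rewrite -in_set2 -gx in_setI xi andbT.
apply: (bits _ _ Cg); rewrite /s /block_bits map_cons g_in // eqxx orbT; congr cons.
rewrite (map_cat _ s1) (map_cons _ r0) (negbTE r0g); congr (_ ++ _ :: _); last first.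
  rewrite -cols -map_comp; apply/eq_in_map => r rS.
  by rewrite /= (nth_map l0) ?size1 // negbK.
apply: (@eq_from_nth _ false); rewrite ?size_map ?size_iota size1 // => j ltj.
rewrite (nth_map l0) ?size1 // (nth_map 0%N) ?size_iota // nth_iota //.
have jS : nth l0 s1 j \in s1 by rewrite mem_nth ?size1.
rewrite g_in ?in1 // nth_uniq ?size1 // (_ : (_ == l0) = false) ?orbF //.
by move: jS; rewrite s1A => /setD1P[/negbTE].
Qed.
End Equivalence.

Theorem theorem1p4 (n : nat) (C : {set 'rV['F_2]_n}) (dperp t : nat) :
  is_linear_code C ->
  const_mx 1 \in C ->
  is_min_dist (dual_code C) dperp ->
  (0 < t)%N ->
  (dperp - t)%N = nb_weights_upto C t ->
  dperp = 8%N -> t = 5%N ->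
  code_equiv C G24.
Proof.
move=> linC C1 minD _ weights dperp8 t5; rewrite dperp8 t5 in minD weights.
case: minD => [[w8 Dw8 [_ wtw8]] dC].
have [n24 cardC weightsC [x Cx wtx]] := golay_parameters linC C1 dC Dw8 wtw8 (esym weights).
exact: (golay_unique n24 linC C1 cardC dC weightsC Cx wtx).
Qed.
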